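(* Let $m\ge1$, $V=\mathbb R^{2m}=\mathbb R^{2m,0}$ and $S=S_{2m,0}$ its spinor module in the model of the context, with operators $E$, $I$, $J$, $K$ and form $h$ as there; write $h_A=h(A\cdot,\cdot)$ and $j_A=j_\rho(h_A)$. (a) If $m\equiv0\pmod4$, every $\mathfrak{so}(2m)$-equivariant embedding $\mathbb R^{2m}\hookrightarrow(S\otimes S)^*$ is a linear combination of the embeddings $$j_\rho(h):\mathbb R^{2m}\hookrightarrow(S^+\wedge S^-)^*,\qquad j_\rho(h_E):\mathbb R^{2m}\hookrightarrow(S^+\vee S^-)^*.$$ (b) If $m\equiv3\pmod4$, every such embedding is a linear combination of $$j_\rho(h):\mathbb R^{2m}\hookrightarrow\wedge^2S^*,\qquad j_\rho(h_J):\mathbb R^{2m}\hookrightarrow\wedge^2S^*.$$ (c) If $m\equiv1$ or $2\pmod4$, every such embedding is a linear combination of the embeddings $j_A$, $A\in\{\mathrm{Id},I,J,K,E,EI,EJ,EK\}$, whose images are contained in the dual of the following subspaces. - $m\equiv1$: $j_{Id},j_{EI}$: $S^+\wedge S^-$; $j_I,j_E$: $S^+\vee S^-$; $j_J,j_K,j_{EJ},j_{EK}$: $\vee^2S^++\vee^2S^-$. - $m\equiv2$: $j_{Id},j_J,j_K,j_{EI}$: $S^+\wedge S^-$; $j_I,j_E,j_{EJ},j_{EK}$: $S^+\vee S^-$.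
   Context: $C\ell_m=C\ell_{m,0}$ is the Clifford algebra of Euclidean $\mathbb R^m$ with $v^2=-\langle v,v\rangle$; $\mathbb C\ell_m=C\ell_m\otimes\mathbb C$; $\alpha$ is the (complex linearly extended) involution equal to $+1$ on the even and $-1$ on the odd part; $\omega=e_1\cdots e_m$ is the volume element of $C\ell_m$ for an orthonormal basis; $L_\omega$ is left multiplication by $\omega$. Decompose orthogonally $\mathbb R^{2m}=\mathbb R^m+\widetilde{\mathbb R^m}$ with an isometry $x\mapsto\tilde x$. The irreducible $C\ell_{2m}$-module $S$ with Clifford multiplication $\rho$ is: - $m\equiv0$: $S=C\ell_m$, $\rho(x)s=xs$, $\rho(\tilde x)s=\omega sx$, $S^+=C\ell_m^0$, $S^-=C\ell_m^1$; - $m\equiv3$: $S=C\ell_m$, $\rho(x)s=xs$, $\rho(\tilde x)s=\omega\alpha(s)x$ (irreducible over $\mathfrak{so}(2m)$); - $m\equiv1,2$: $S=\mathbb C\ell_m$ as a real vector space, $\rho(x)s=xs$, $\rho(\tilde x)s=i\alpha(s)x$, $S^+=\mathbb C\ell^0_m$, $S^-=\mathbb C\ell_m^1$ (all mod 4, $x\in\mathbb R^m$). $h$ is the positive definite scalar product on $S$ invariant under $\rho(v)$ for unit vectors $v\in\mathbb R^{2m}$ (unique up to scale). Operators: $E=\alpha$ if $m\equiv0,1,2$; $J=L_\omega\circ\alpha$ if $m\equiv3$; for $m\equiv1,2$: $I:s\mapsto is$, $J=L_\omega\circ c$, $K=IJ$, with $c$ complex conjugation of $\mathbb C\ell_m$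 with respect to $C\ell_m$. $j_\rho(\beta)(v)=\beta(\rho(v)\cdot,\cdot)$. Image in the dual of: $\wedge^2S$ means all forms $j(v)$ are skew symmetric; $\vee^2S^++\vee^2S^-$: symmetric with $S^+\perp S^-$; $S^+\vee S^-$: symmetric with $S^\pm$ isotropic; $S^+\wedge S^-$: skew symmetric with $S^\pm$ isotropic. *)

(* Defs.v *)
From HB Require Import structures.
From mathcomp Require Import all_boot all_order all_algebra.
From mathcomp Require Import complex.
From mathcomp Require Import reals ring.

Set Implicit Arguments.
Unset Strict Implicit.
Unset Printing Implicit Defensive.

Import GRing.Theory Num.Theory.

Local Open Scope ring_scope.

Definition edot (F : comNzRingType) n (v w : 'rV[F]_n) : F :=
  \sum_i v 0 i * w 0 i.

(* The Clifford algebra of the quadratic form -(x_1^2 + ... + x_m^2) over F,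
   on the basis e_A = e_{i_1} ... e_{i_k}, A = {i_1 < ... < i_k}: an element is
   its family of coordinates.  Reordering e_A e_B costs one sign for each pair
   j < i with i in A and j in B, and one more for each square e_i^2 = -1, so
   e_A e_B = csign A B e_C with C the symmetric difference of A and B.  The
   lemmas cvec_sqr and cbasis_prod below record the defining relation and the
   fact that the cbasis A are the ordered monomials in the generators. *)

Section CliffordAlgebra.
Variables (F : comNzRingType) (m : nat).
Implicit Types A B C D : {set 'I_m}.

Definition symdiff A B : {set 'I_m} := [set i | (i \in A) (+) (i \in B)].

Definition csign A B : F :=
  (-1) ^+ #|[set p in setX A B | (p.2 <= p.1)%N]|.

Definition clifford : Type := {ffun {set 'I_m} -> F^o}.
HB.instance Definition _ := GRing.Lmodule.on clifford.

Implicit Types x y z : clifford.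

Definition cbasis A : clifford := [ffun B => (A == B)%:R].
Definition cone : clifford := cbasis set0.
(* For fixed A and C, the only B with e_A e_B proportional to e_C is
   symdiff A C. *)
Definition cmul x y : clifford :=
  [ffun C => \sum_A csign A (symdiff A C) * (x A * y (symdiff A C))].

Lemma symdiffC A B : symdiff A B = symdiff B A.
Proof. by apply/setP=> i; rewrite !inE addbC. Qed.

Lemma symdiffA A B C : symdiff A (symdiff B C) = symdiff (symdiff A B) C.
Proof. by apply/setP=> i; rewrite !inE addbA. Qed.

Lemma symdiff0 A : symdiff A set0 = A.
Proof. by apply/setP=> i; rewrite !inE addbF. Qed.

Lemma symdiffxx A : symdiff A A = set0.
Proof. by apply/setP=> i; rewrite !inE addbb. Qed.

Lemma symdiffK A : involutive (symdiff A).
Proof. by move=> B; rewrite symdiffA symdiffxx symdiffC symdiff0. Qed.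

Lemma csignE A B :
  csign A B = \prod_i \prod_j
    (-1) ^+ ((i \in A) && (j \in B) && (j <= i)%N).
Proof.
rewrite pair_big prodrXr /csign -sum1dep_card big_mkcond /=; congr (_ ^+ _).
by apply: eq_bigr => -[i j] _; rewrite !inE /=; case: ifP.
Qed.

Lemma csignDl A B C : csign (symdiff A B) C = csign A C * csign B C.
Proof.
rewrite !csignE -big_split; apply: eq_bigr => i _.
rewrite -big_split; apply: eq_bigr => j _ /=; rewrite !inE.
by case: (i \in A); case: (i \in B); case: (j \in C); case: (j <= i)%N;
  rewrite /= ?expr0 ?expr1 ?mulr1 ?mul1r ?mulrNN ?mulr1.
Qed.

Lemma csignDr A B C : csign A (symdiff B C) = csign A B * csign A C.
Proof.
rewrite !csignE -big_split; apply: eq_bigr => i _.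
rewrite -big_split; apply: eq_bigr => j _ /=; rewrite !inE.
by case: (i \in A); case: (j \in B); case: (j \in C); case: (j <= i)%N;
  rewrite /= ?expr0 ?expr1 ?mulr1 ?mul1r ?mulrNN ?mulr1.
Qed.

Lemma csign0l A : csign set0 A = 1.
Proof.
rewrite csignE big1 // => i _; rewrite big1 // => j _.
by rewrite inE expr0.
Qed.

Lemma csign0r A : csign A set0 = 1.
Proof.
rewrite csignE big1 // => i _; rewrite big1 // => j _.
by rewrite inE andbF expr0.
Qed.

Lemma csign_sqr A B : csign A B * csign A B = 1.
Proof. by rewrite -expr2 /csign sqrr_sign. Qed.

Lemma csign_cocycle A C D :
  csign A (symdiff A C) * csign C (symdiff C D) =
  csign A (symdiff A D) * csign (symdiff A C) (symdiff C D).
Proof.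
have -> : symdiff A D = symdiff (symdiff A C) (symdiff C D).
  by rewrite symdiffA -[symdiff (symdiff A C) C]symdiffA symdiffxx symdiff0.
rewrite [csign A (symdiff _ (symdiff C D))]csignDr csignDl -!mulrA.
by congr (_ * _); rewrite mulrA csign_sqr mul1r.
Qed.

Lemma cmulA : associative cmul.
Proof.
move=> x y z; apply/ffunP=> D; rewrite !ffunE.
transitivity (\sum_A \sum_C csign A (symdiff A D) * csign (symdiff A C)
    (symdiff C D) * (x A * (y (symdiff A C) * z (symdiff C D)))).
  apply: eq_bigr => A _; rewrite ffunE (reindex_inj (inv_inj (symdiffK A))) /=.
  rewrite mulr_sumr mulr_sumr; apply: eq_bigr => C _.
  have -> : symdiff (symdiff A C) (symdiff A D) = symdiff C D.
    by rewrite symdiffA [symdiff A C]symdiffC -[symdiff (symdiff C A) A]symdiffA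
       symdiffxx symdiff0.
  by rewrite -[RHS]mulrA; congr (_ * _); exact: mulrCA.
rewrite exchange_big /=; apply: eq_bigr => C _.
rewrite ffunE mulr_suml mulr_sumr; apply: eq_bigr => A _.
rewrite -csign_cocycle -!mulrA [RHS]mulrCA; congr (_ * _).
Qed.

Lemma cmul1l : left_id cone cmul.
Proof.
move=> x; apply/ffunP=> C; rewrite !ffunE (bigD1 set0) //= big1 ?addr0.
  by rewrite ffunE eqxx mul1r symdiffC symdiff0 csign0l mul1r.
by move=> A /negPf nA; rewrite ffunE eq_sym nA mul0r mulr0.
Qed.

Lemma cmul1r : right_id cone cmul.
Proof.
move=> x; apply/ffunP=> C; rewrite !ffunE (bigD1 C) //= big1 ?addr0.
  by rewrite ffunE symdiffxx eqxx mulr1 csign0r mul1r.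
move=> A nA; rewrite ffunE; case: eqP => [e|_]; last by rewrite !mulr0.
by case/eqP: nA; rewrite -[RHS](symdiffK A) -e symdiff0.
Qed.

Lemma cmulDl : left_distributive cmul +%R.
Proof.
move=> x y z; apply/ffunP=> C; rewrite !ffunE -big_split.
by apply: eq_bigr => A _; rewrite ffunE mulrDl mulrDr.
Qed.

Lemma cmulDr : right_distributive cmul +%R.
Proof.
move=> x y z; apply/ffunP=> C; rewrite !ffunE -big_split.
by apply: eq_bigr => A _; rewrite ffunE !mulrDr.
Qed.

Lemma cone_neq0 : cone != 0.
Proof. by apply/eqP=> /ffunP/(_ set0)/eqP; rewrite !ffunE eqxx oner_eq0. Qed.

HB.instance Definition _ := GRing.Zmodule_isNzRing.Build clifford
  cmulA cmul1l cmul1r cmulDl cmulDr cone_neq0.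

Lemma cscaleAl (a : F) x y : a *: (x * y) = (a *: x) * y.
Proof.
apply/ffunP=> C; rewrite !ffunE scaler_sumr; apply: eq_bigr => A _.
by rewrite ffunE /GRing.scale /= mulrCA !mulrA.
Qed.

Lemma cscaleAr (a : F) x y : a *: (x * y) = x * (a *: y).
Proof.
apply/ffunP=> C; rewrite !ffunE scaler_sumr; apply: eq_bigr => A _.
by rewrite ffunE /GRing.scale /= mulrCA; congr (_ * _); exact: mulrCA.
Qed.

HB.instance Definition _ := GRing.Lmodule_isLalgebra.Build F clifford cscaleAl.
HB.instance Definition _ := GRing.Lalgebra_isAlgebra.Build F clifford cscaleAr.

Definition cgen (i : 'I_m) : clifford := cbasis [set i].

Definition cvec (v : 'rV[F]_m) : clifford := \sum_i v 0 i *: cgen i.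

Definition cvol : clifford := \prod_(i < m) cgen i.

Definition calpha x : clifford := [ffun A : {set 'I_m} => (-1) ^+ #|A| * x A].

Definition ceven x : Prop := forall A, odd #|A| -> x A = 0.
Definition codd x : Prop := forall A, ~~ odd #|A| -> x A = 0.

Lemma cbasisM A B : cbasis A * cbasis B = csign A B *: cbasis (symdiff A B).
Proof.
apply/ffunP=> C; rewrite !ffunE (bigD1 A) //= big1 ?addr0.
  rewrite !ffunE eqxx mul1r; case: (B =P _) => [->|nB].
    by rewrite symdiffK eqxx.
  case: eqP => [e|]; last by rewrite mulr0 scaler0.
  by case: nB; rewrite -e symdiffK.
by move=> A' /negPf nA; rewrite !ffunE eq_sym nA mul0r mulr0.
Qed.

Lemma cgen_sqr i : cgen i * cgen i = -1.
Proof.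
rewrite cbasisM symdiffxx.
have -> : csign [set i] [set i] = -1; last by rewrite scaleN1r.
rewrite /csign (_ : [set _ in _ | _] = [set (i, i)]) ?cards1 //.
apply/setP=> -[j k]; rewrite !inE xpair_eqE /=.
by case: (j =P i) => // ->; case: (k =P i) => // ->; rewrite leqnn.
Qed.

Lemma csign1 i j : csign [set i] [set j] = (-1) ^+ (j <= i)%N.
Proof.
rewrite /csign; congr (_ ^+ _); case: (leqP j i) => ji.
  rewrite (_ : [set _ in _ | _] = [set (i, j)]) ?cards1 //.
  apply/setP=> -[k l]; rewrite !inE xpair_eqE /=.
  by case: (k =P i) => // ->; case: (l =P j) => // ->.
rewrite (_ : [set _ in _ | _] = set0) ?cards0 //.
apply/setP=> -[k l]; rewrite !inE /=.
by case: (k =P i) => // ->; case: (l =P j) => // ->; rewrite leqNgt ji.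
Qed.

Lemma cgen_anti i j : i != j -> cgen i * cgen j = - (cgen j * cgen i).
Proof.
rewrite neq_ltn !cbasisM !csign1 [symdiff [set j] _]symdiffC.
case/orP=> ij; rewrite [(i <= j)%N]leqNgt [(j <= i)%N]leqNgt ij.
  by rewrite ltnNge (ltnW ij) /= expr1 expr0 scaleN1r scale1r opprK.
by rewrite ltnNge (ltnW ij) /= expr1 expr0 scaleN1r scale1r.
Qed.

Lemma cvec_sqr v : cvec v * cvec v = - (edot v v)%:A.
Proof.
pose G i j := (v 0 i * v 0 j) *: (cgen i * cgen j).
have -> : cvec v * cvec v = \sum_i \sum_j G i j.
  rewrite mulr_suml; apply: eq_bigr => i _; rewrite mulr_sumr.
  by apply: eq_bigr => j _; rewrite -scalerAl -scalerAr scalerA.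
have -> : \sum_i \sum_j G i j =
    \sum_i G i i + (\sum_(i < m) \sum_(j < m | (j < i)%N) G i j +
                    \sum_(i < m) \sum_(j < m | (i < j)%N) G i j).
  rewrite -!big_split; apply: eq_bigr => i _ /=.
  rewrite (bigD1 i) //= (bigID (fun j : 'I_m => (j < i)%N)) /=.
  congr (_ + (_ + _)); apply: eq_bigl => j; rewrite -(inj_eq val_inj) /=.
    by case: ltngtP.
  by case: ltngtP.
rewrite [X in _ + (_ + X)](exchange_big_dep xpredT) //= -big_split /=.
rewrite [X in _ + X]big1 ?addr0 => [|i _].
  rewrite scaler_suml -sumrN; apply: eq_bigr => i _.
  by rewrite /G cgen_sqr scalerN.
rewrite -big_split big1 //= => j ji.
by rewrite /G cgen_anti ?scalerN 1?mulrC ?addNr // neq_ltn ji orbT.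
Qed.

Lemma cbasis_prod A : cbasis A = \prod_(i in A) cgen i.
Proof.
rewrite -big_filter; set s := filter _ _.
have ss : sorted ltn (map val s).
  apply: (subseq_sorted ltn_trans (map_subseq val (filter_subseq _ _))).
  by rewrite [index_enum _]unlock -enumT val_enum_ord iota_ltn_sorted.
have -> : A = [set:: s].
  by apply/setP=> i; rewrite inE mem_filter mem_index_enum andbT.
elim: s ss => [|i s IHs] /= ss.
  by rewrite big_nil; congr cbasis; apply/setP=> i; rewrite !inE.
have lts j : j \in s -> (i < j)%N.
  move=> js; move: (order_path_min ltn_trans ss) => /allP; apply.
  exact: map_f.
rewrite big_cons -IHs ?(path_sorted ss) // cbasisM.
have -> : symdiff [set i] [set:: s] = [set:: i :: s].
  apply/setP=> j; rewrite !inE; case: (j =P i) => [->|//] /=.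
  by case: (boolP (i \in s)) => // /lts; rewrite ltnn.
have -> : csign [set i] [set:: s] = 1; last by rewrite scale1r.
rewrite /csign (_ : [set _ in _ | _] = set0) ?cards0 //.
apply/setP=> -[k l]; rewrite !inE /=.
case: (k =P i) => //= ->; case: (boolP (l \in s)) => //= /lts.
by rewrite ltnNge => /negPf.
Qed.

End CliffordAlgebra.

(* Restriction of scalars from R[i] to R. *)
Definition realified (R : rcfType) (V : lmodType R[i]) : Type := V.

Section Realified.
Variables (R : rcfType) (V : lmodType R[i]).

HB.instance Definition _ := GRing.Zmodule.copy (realified V) V.

Definition rscale (a : R) (v : realified V) : realified V :=
  real_complex R a *: (v : V).

Lemma rscaleA a b v : rscale a (rscale b v) = rscale (a * b) v.
Proof. by rewrite /rscale scalerA -rmorphM. Qed.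

Lemma rscale1 : left_id 1 rscale.
Proof. by move=> v; rewrite /rscale rmorph1 scale1r. Qed.

Lemma rscaleDr : right_distributive rscale +%R.
Proof. by move=> a u v; rewrite /rscale scalerDr. Qed.

Lemma rscaleDl v : {morph rscale^~ v : a b / a + b}.
Proof. by move=> a b; rewrite /rscale rmorphD scalerDl. Qed.

HB.instance Definition _ := GRing.Zmodule_isLmodule.Build R (realified V)
  rscaleA rscale1 rscaleDr rscaleDl.

End Realified.

Section EquivariantForms.
Variables (R : realType) (n : nat) (S : lmodType R).
Variable rho : 'rV[R]_n -> S -> S.
Implicit Types (v w : 'rV[R]_n) (s t : S) (b h : S -> S -> R).
Implicit Types (f : 'rV[R]_n -> S -> S -> R) (A : 'M[R]_n).

(* (S (x) S)^* is the space of real bilinear forms on S. *)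
Definition bilinear_form b : Prop :=
  (forall t, scalar (b^~ t)) /\ (forall s, scalar (b s)).

Definition invariant_inner_product h : Prop :=
  [/\ bilinear_form h,
      forall s t, h s t = h t s,
      forall s, s != 0 -> 0 < h s s &
      forall v, edot v v = 1 -> forall s t, h (rho v s) (rho v t) = h s t].

(* so(n) acts on R^n by v |-> A v, i.e. v *m A^T on row vectors. *)
Definition so_mx A : Prop := A^T = - A.
Definition so_vec A v : 'rV[R]_n := v *m A^T.

(* The infinitesimal spin action of so(n) on S, normalised by
   [spin_action A, rho v] = rho (A v); see spin_action_commutator. *)
Definition spin_action A s : S :=
  - (4^-1 *: \sum_i \sum_j
       A i j *: rho (delta_mx 0 i) (rho (delta_mx 0 j) s)).

Lemma spin_action_commutator A v s :
    (forall u, linear (rho^~ u)) -> (forall w, linear (rho w)) ->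
    (forall w u, rho w (rho w u) = - edot w w *: u) -> so_mx A ->
  spin_action A (rho v s) - rho v (spin_action A s) = rho (so_vec A v) s.
Proof.
move=> rhoL rhoR cliff soA.
have rhoDl w w' u : rho (w + w') u = rho w u + rho w' u.
  by have := rhoL u 1 w w'; rewrite !scale1r.
have rho0l u : rho 0 u = 0.
  by have := rhoL u (-1) 0 0; rewrite scaler0 addr0 scaleN1r addNr.
have rhoZl a w u : rho (a *: w) u = a *: rho w u.
  by have := rhoL u a w 0; rewrite rho0l !addr0.
have rhoDr w u u' : rho w (u + u') = rho w u + rho w u'.
  by have := rhoR w 1 u u'; rewrite !scale1r.
have rho0r w : rho w 0 = 0.
  by have := rhoR w (-1) 0 0; rewrite scaler0 addr0 scaleN1r addNr.
have rhoZr a w u : rho w (a *: u) = a *: rho w u.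
  by have := rhoR w a u 0; rewrite rho0r !addr0.
have rhoNr w u : rho w (- u) = - rho w u by rewrite -scaleN1r rhoZr scaleN1r.
have rhosl I (r : seq I) P (F : I -> 'rV[R]_n) u :
    rho (\sum_(i <- r | P i) F i) u = \sum_(i <- r | P i) rho (F i) u.
  exact: (big_morph (rho^~ u) (fun w w' => rhoDl w w' u) (rho0l u)).
have rhosr I (r : seq I) P (F : I -> S) w :
    rho w (\sum_(i <- r | P i) F i) = \sum_(i <- r | P i) rho w (F i).
  exact: (big_morph (rho w) (rhoDr w) (rho0r w)).
have edotDl w w' w'' : edot (w + w') w'' = edot w w'' + edot w' w''.
  by rewrite -big_split; apply: eq_bigr => i _; rewrite mxE mulrDl.
have edotC w w' : edot w w' = edot w' w.
  by apply: eq_bigr => i _; rewrite mulrC.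
have anti w w' u :
    rho w (rho w' u) = - rho w' (rho w u) - (edot w w' *+ 2) *: u.
  have := cliff (w + w') u; rewrite !rhoDl !rhoDr !cliff.
  rewrite edotDl ![edot _ (w + w')]edotC !edotDl [edot w' w]edotC.
  set p := edot w w; set q := edot w w'; set r := edot w' w'.
  set x := rho w _; set y := rho w' _ => e.
  apply: (addIr y); rewrite addrAC addNr add0r -scaleNr.
  apply: (addrI (- p *: u)); apply: (addIr (- r *: u)).
  rewrite !addrA in e *; rewrite e -!scalerDl; congr (_ *: u); ring.
have edot_delta w i : edot (delta_mx 0 i) w = w 0 i.
  rewrite /edot (bigD1 i) //= big1 ?addr0 => [|j /negPf ji].
    by rewrite mxE !eqxx mul1r.
  by rewrite mxE eqxx ji mul0r.
have term i j : rho (delta_mx 0 i) (rho (delta_mx 0 j) (rho v s))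
    - rho v (rho (delta_mx 0 i) (rho (delta_mx 0 j) s)) =
    (v 0 i *+ 2) *: rho (delta_mx 0 j) s - (v 0 j *+ 2) *: rho (delta_mx 0 i) s.
  rewrite [rho (delta_mx 0 j) (rho v s)]anti edot_delta rhoDr !rhoNr rhoZr.
  rewrite [rho (delta_mx 0 i) (rho v _)]anti edot_delta.
  by rewrite opprD !opprK addrAC [X in X - _ = _]addrAC subrr add0r.
have Askew i j : A j i = - A i j by have /matrixP/(_ i j) := soA; rewrite !mxE.
set W := \sum_i \sum_j (A i j * v 0 j) *: rho (delta_mx 0 i) s.
have WE : W = rho (so_vec A v) s.
  rewrite [so_vec A v]row_sum_delta rhosl; apply: eq_bigr => i _.
  rewrite rhoZl mxE scaler_suml; apply: eq_bigr => j _.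
  by rewrite mxE mulrC.
have W'E : \sum_i \sum_j (A i j * v 0 i) *: rho (delta_mx 0 j) s = - W.
  rewrite exchange_big /= -sumrN; apply: eq_bigr => i _.
  by rewrite -sumrN; apply: eq_bigr => j _; rewrite Askew mulNr scaleNr.
rewrite /spin_action rhoNr rhoZr rhosr -opprD -scalerBr -sumrB.
rewrite (eq_bigr (fun i => \sum_j ((A i j * v 0 i) *: rho (delta_mx 0 j) s *+ 2
   - (A i j * v 0 j) *: rho (delta_mx 0 i) s *+ 2))) => [|i _]; last first.
  rewrite rhosr -sumrB; apply: eq_bigr => j _.
  rewrite rhoZr -scalerBr term scalerBr !scalerA.
  by rewrite !mulrnAr -!scalerMnl.
rewrite (eq_bigr _ (fun i _ => sumrB _ _ _ _)) sumrB.
rewrite !(eq_bigr _ (fun i _ => sumrMnl _ _ _ _)) !sumrMnl W'E -/W -WE.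
rewrite mulNrn -opprD scalerN opprK -mulrnDr -scaler_nat scalerA mulVf.
  by rewrite scale1r.
by rewrite pnatr_eq0.
Qed.

Definition equivariant f : Prop :=
  forall A, so_mx A -> forall v s t,
    f (so_vec A v) s t =
    - f v (spin_action A s) t - f v s (spin_action A t).

Definition equivariant_embedding f : Prop :=
  [/\ forall v, bilinear_form (f v),
      forall s t, scalar (fun v => f v s t),
      forall v w, (forall s t, f v s t = f w s t) -> v = w &
      equivariant f].

Definition jrho b v s t : R := b (rho v s) t.
Definition form_op h (T : S -> S) s t : R := h (T s) t.

Definition jspan h (ops : seq (S -> S)) f : Prop :=
  exists c : 'I_(size ops) -> R, forall v s t,
    f v s t = \sum_k c k * jrho (form_op h (nth id ops k)) v s t.

Definition embeds_into (P : (S -> S -> R) -> Prop) f : Prop :=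
  equivariant_embedding f /\ forall v, P (f v).

Definition symmetric_form b : Prop := forall s t, b s t = b t s.
Definition skew_form b : Prop := forall s t, b s t = - b t s.

(* For S = S^+ + S^-: the forms in the dual of S^+ /\ S^-, of S^+ \/ S^- and
   of \/^2 S^+ + \/^2 S^-. *)
Variables Sp Sm : S -> Prop.

Definition isotropic (P : S -> Prop) b : Prop :=
  forall s t, P s -> P t -> b s t = 0.
Definition wedge_pm b : Prop :=
  [/\ skew_form b, isotropic Sp b & isotropic Sm b].
Definition vee_pm b : Prop :=
  [/\ symmetric_form b, isotropic Sp b & isotropic Sm b].
Definition vee2_sum b : Prop :=
  symmetric_form b /\ forall s t, Sp s -> Sm t -> b s t = 0.

End EquivariantForms.

(* Spinor module of R^m + R^m, the first summand being R^m and the second its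
   isometric copy: v = x + y~ with x = lsubmx v and y = rsubmx v. *)
Section SpinorModules.
Variables (R : realType) (m : nat).

Definition rho_0mod4 (v : 'rV[R]_(m + m)) (s : clifford R m) : clifford R m :=
  cvec (lsubmx v) * s + cvol R m * s * cvec (rsubmx v).

Definition rho_3mod4 (v : 'rV[R]_(m + m)) (s : clifford R m) : clifford R m :=
  cvec (lsubmx v) * s + cvol R m * calpha s * cvec (rsubmx v).

(* Cl_m (x) C is the Clifford algebra over R[i], with Cl_m as the elements
   having real coordinates. *)
Definition cclifford : lmodType R := realified (clifford R[i] m).

Definition cvecC (x : 'rV[R]_m) : clifford R[i] m :=
  cvec (map_mx (real_complex R) x).

Definition cconj (s : clifford R[i] m) : clifford R[i] m :=
  [ffun A : {set 'I_m} => conjc (s A)].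

Definition rho_12mod4 (v : 'rV[R]_(m + m)) (s : cclifford) : cclifford :=
  cvecC (lsubmx v) * (s : clifford R[i] m) +
  ('i%C : R[i]) *: (calpha s * cvecC (rsubmx v)).

Definition opJ3 (s : clifford R m) : clifford R m := cvol R m * calpha s.

Definition opE (s : cclifford) : cclifford := calpha (s : clifford R[i] m).
Definition opI (s : cclifford) : cclifford :=
  ('i%C : R[i]) *: (s : clifford R[i] m).
Definition opJ (s : cclifford) : cclifford := cvol R[i] m * cconj s.
Definition opK (s : cclifford) : cclifford := opI (opJ s).

Definition cS_even (s : cclifford) : Prop := ceven (s : clifford R[i] m).
Definition cS_odd (s : cclifford) : Prop := codd (s : clifford R[i] m).

End SpinorModules.

(* Main.v *)
Require Import Defs.
From mathcomp Require Import all_boot all_order all_algebra.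
From mathcomp Require Import complex.
From mathcomp Require Import reals ring lra zify.

Import Order.TTheory GRing.Theory Num.Theory.

Local Open Scope ring_scope.

Set Implicit Arguments.
Unset Strict Implicit.

(** Write e_k for the action on S of the k-th basis vector of V = R^n, n = 2m.

    From equivariant maps to invariant forms.  Let f be equivariant and
    a = e_i e_j with i <> j, which generates the rotations of the plane of the
    i-th and j-th basis vectors.  Equivariance under that rotation reads
    f(e_i)(as, t) = f(e_i)(s, at) and f(e_j)(s, t) = - f(e_i)(as, t).  Hence
    g(s, t) = - f(e_i)(e_i s, t) does not depend on i, f(v)(s, t) = g(vs, t)
    for every v, and g(as, t) = - g(s, at).  So all the forms g(e_k s, e_k t)
    are equal, and g is the sum of a form with b(e_k s, e_k t) = b(s, t) and of
    one with b(e_k s, e_k t) = - b(s, t) (equivariant_decomposition).  Composing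
    the second one with an operator that anticommutes with Clifford
    multiplication (alpha, L_w alpha or E) turns it into one of the first kind,
    so only those have to be classified.

    Classification.  Let b be a bilinear form on the Clifford algebra that is
    invariant under the maps s |-> e_i s and s |-> alpha(s) e_i.  The first
    invariance reduces b(e_A, e_B) to the numbers b(1, e_C).  For i in C the map
    s |-> e_i alpha(s) e_i sends 1 to -1 and e_C to e_C, so b(1, e_C) = 0 unless
    C is empty: b is a multiple of the standard form (clifford_form_unique).
    For m = 0 and 3 mod 4 this applies directly.  For m = 1 and 2 mod 4,
    multiplication by i commutes with the action.  If b is I-invariant, then
    b(s, conj t) - i b(is, conj t) is complex bilinear and the same lemma
    applies; the I-anti-invariant part is brought to this case by the operator
    Q s = conj(s) w, which is antilinear and commutes with the action.  The
    outcome is that the forms of the first kind are spanned by h, h_I, h_Q and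
    h_IQ, where Q is J or E J according to the parity of m.  The same
    classification applied to h itself shows that h is a multiple of the
    standard form, so that E, I, J are isometries of h.

    Symmetry.  If A is an isometry of h with A^2 = +-1 that commutes or
    anticommutes with the action and with the parity operator, these signs
    decide whether j_A(v) is symmetric or skew (jrho_symmetry) and which of its
    blocks on S^+ and S^- vanish (jrho_parity). *)

(** * Bilinear forms and linear operators *)

Section Bilinear.
Variables (R : comNzRingType) (S : lmodType R) (b : S -> S -> R).
(* For real scalars this is bilinear_form; complex scalars occur as well. *)
Hypothesis bb : (forall t, scalar (b^~ t)) /\ (forall s, scalar (b s)).

Lemma bilinDl s s' t : b (s + s') t = b s t + b s' t.
Proof. by have := bb.1 t 1 s s'; rewrite !(scale1r, mul1r). Qed.

Lemma bilinDr s t t' : b s (t + t') = b s t + b s t'.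
Proof. by have := bb.2 s 1 t t'; rewrite !(scale1r, mul1r). Qed.

Lemma bilin0l t : b 0 t = 0.
Proof. by apply: (addrI (b 0 t)); rewrite -bilinDl !addr0. Qed.

Lemma bilin0r s : b s 0 = 0.
Proof. by apply: (addrI (b s 0)); rewrite -bilinDr !addr0. Qed.

Lemma bilinZl a s t : b (a *: s) t = a * b s t.
Proof. by have := bb.1 t a s 0; rewrite bilin0l !addr0. Qed.

Lemma bilinZr a s t : b s (a *: t) = a * b s t.
Proof. by have := bb.2 s a t 0; rewrite bilin0r !addr0. Qed.

Lemma bilinNl s t : b (- s) t = - b s t.
Proof. by rewrite -scaleN1r bilinZl mulN1r. Qed.

Lemma bilinNr s t : b s (- t) = - b s t.
Proof. by rewrite -scaleN1r bilinZr mulN1r. Qed.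

Lemma bilin_suml I (r : seq I) (P : pred I) (F : I -> S) t :
  b (\sum_(i <- r | P i) F i) t = \sum_(i <- r | P i) b (F i) t.
Proof. exact: (big_morph (b^~ t) (fun s s' => bilinDl s s' t) (bilin0l t)). Qed.

Lemma bilin_sumr I (r : seq I) (P : pred I) (F : I -> S) s :
  b s (\sum_(i <- r | P i) F i) = \sum_(i <- r | P i) b s (F i).
Proof. exact: (big_morph (b s) (bilinDr s) (bilin0r s)). Qed.

End Bilinear.

Lemma bilin_opl (R : realType) (S : lmodType R) (b : S -> S -> R) (A : S -> S) :
  bilinear_form b -> linear A -> bilinear_form (form_op b A).
Proof.
by move=> bb linA; split=> [t a u v|s a u v]; rewrite /form_op ?linA;
   [rewrite (bilinDl bb) (bilinZl bb) | rewrite (bilinDr bb) (bilinZr bb)].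
Qed.

Lemma linear_scale (R : comNzRingType) (S : lmodType R) (A : S -> S) :
  linear A -> forall a s, A (a *: s) = a *: A s.
Proof.
move=> linA a s; have A0 : A 0 = 0.
  by have := linA (-1) 0 0; rewrite scaler0 addr0 scaleN1r addNr.
by have := linA a s 0; rewrite A0 !addr0.
Qed.

Lemma sign_commute_comp (R : comNzRingType) (S : lmodType R) (A B E : S -> S)
    (d d' : bool) : linear A ->
    (forall s, A (E s) = (-1) ^+ d *: E (A s)) ->
    (forall s, B (E s) = (-1) ^+ d' *: E (B s)) ->
  forall s, (A \o B) (E s) = (-1) ^+ (d (+) d') *: E ((A \o B) s).
Proof.
move=> linA AE BE s /=.
by rewrite BE (linear_scale linA) AE scalerA -signr_addb addbC.
Qed.

Lemma edot_delta (R : comNzRingType) n i (w : 'rV[R]_n) :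
  edot (delta_mx 0 i) w = w 0 i.
Proof.
rewrite /edot (bigD1 i) //= big1 ?addr0 => [|j /negPf ji].
  by rewrite mxE !eqxx mul1r.
by rewrite mxE eqxx ji mul0r.
Qed.

Lemma edot_eq0 (R : realDomainType) n (w : 'rV[R]_n) : edot w w = 0 -> w = 0.
Proof.
move=> /eqP; rewrite /edot psumr_eq0 => [/allP w0|i _]; last first.
  by rewrite -expr2 sqr_ge0.
apply/rowP=> i; rewrite mxE; have /= := w0 i (mem_index_enum i).
by rewrite mulf_eq0 orbb => /eqP.
Qed.

(** * Clifford modules *)

Section CliffordModule.
Variables (R : realType) (n : nat) (S : lmodType R).
Variable rho : 'rV[R]_n -> S -> S.
Implicit Types (v w : 'rV[R]_n) (s t : S) (b : S -> S -> R).

(** A module over the Clifford algebra of (R^n, - <v, v>). *)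
Definition clifford_module : Prop :=
  [/\ forall u, linear (rho^~ u), forall w, linear (rho w) &
      forall w u, rho w (rho w u) = - edot w w *: u].

(** Bilinear forms for which every basis vector acts as an isometry
    (tau = false) or as an anti-isometry (tau = true). *)
Definition typed_form (tau : bool) b : Prop :=
  bilinear_form b /\ forall k s t,
    b (rho (delta_mx 0 k) s) (rho (delta_mx 0 k) t) = (-1) ^+ tau * b s t.

(** Composing with an operator that commutes with the action preserves the type;
    composing with one that anticommutes with it exchanges the two types. *)
Lemma typed_form_op tau (kap : bool) A b : linear A ->
  (forall v s, A (rho v s) = (-1) ^+ kap *: rho v (A s)) ->
  typed_form tau b -> typed_form (kap (+) tau) (form_op b A).
Proof.
move=> linA rA [bb bt]; split=> [|k s t]; first exact: bilin_opl.
by rewrite /form_op rA (bilinZl bb) bt signr_addb mulrA.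
Qed.

Lemma typed_form_op2 tau (kap : bool) A b : linear A ->
  (forall v s, A (rho v s) = (-1) ^+ kap *: rho v (A s)) ->
  typed_form tau b -> typed_form tau (fun s t => b (A s) (A t)).
Proof.
move=> linA rA [bb bt]; split=> [|k s t].
  split=> [t a u v|s a u v]; rewrite linA.
    by rewrite (bilinDl bb) (bilinZl bb).
  by rewrite (bilinDr bb) (bilinZr bb).
by rewrite !rA (bilinZl bb) (bilinZr bb) bt mulrA -expr2 sqrr_sign mul1r.
Qed.

Lemma typed_form_lin tau b b' x y : typed_form tau b -> typed_form tau b' ->
  typed_form tau (fun s t => x * b s t + y * b' s t).
Proof.
move=> [bb bt] [bb' bt']; split=> [|k s t]; last by rewrite bt bt'; ring.
split=> [t a u v|s a u v].
  by rewrite !(bilinDl bb) !(bilinZl bb) !(bilinDl bb') !(bilinZl bb'); ring.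
by rewrite !(bilinDr bb) !(bilinZr bb) !(bilinDr bb') !(bilinZr bb'); ring.
Qed.

Hypothesis cmod : clifford_module.

Lemma rhoDl w w' u : rho (w + w') u = rho w u + rho w' u.
Proof. by case: cmod => L _ _; have := L u 1 w w'; rewrite !scale1r. Qed.
Lemma rho0l u : rho 0 u = 0.
Proof. by apply: (addrI (rho 0 u)); rewrite -rhoDl !addr0. Qed.
Lemma rhoZl a w u : rho (a *: w) u = a *: rho w u.
Proof. by case: cmod => L _ _; have := L u a w 0; rewrite rho0l !addr0. Qed.
Lemma rhoDr w u u' : rho w (u + u') = rho w u + rho w u'.
Proof. by case: cmod => _ L _; have := L w 1 u u'; rewrite !scale1r. Qed.
Lemma rho0r w : rho w 0 = 0.
Proof. by apply: (addrI (rho w 0)); rewrite -rhoDr !addr0. Qed.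
Lemma rhoZr a w u : rho w (a *: u) = a *: rho w u.
Proof. by case: cmod => _ L _; have := L w a u 0; rewrite rho0r !addr0. Qed.
Lemma rhoNr w u : rho w (- u) = - rho w u.
Proof. by rewrite -scaleN1r rhoZr scaleN1r. Qed.
Lemma rho_suml I (r : seq I) (P : pred I) (F : I -> 'rV[R]_n) u :
  rho (\sum_(i <- r | P i) F i) u = \sum_(i <- r | P i) rho (F i) u.
Proof. exact: (big_morph (rho^~ u) (fun w w' => rhoDl w w' u) (rho0l u)). Qed.

Local Notation e i := (delta_mx 0 i : 'rV[R]_n).

Lemma rho_coord v s : rho v s = \sum_i v 0 i *: rho (e i) s.
Proof.
by rewrite [v in LHS]row_sum_delta rho_suml; apply: eq_bigr => i _; rewrite rhoZl.
Qed.

Lemma rho_delta_sqr i s : rho (e i) (rho (e i) s) = - s.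
Proof.
case: cmod => _ _ ->.
by rewrite edot_delta mxE !eqxx scaleNr scale1r.
Qed.

Lemma rho_delta_anti i j s :
  i != j -> rho (e i) (rho (e j) s) = - rho (e j) (rho (e i) s).
Proof.
move=> ij; case: cmod => _ _ cliff; have := cliff (e i + e j) s.
rewrite !rhoDl !rhoDr !rho_delta_sqr.
have -> : edot (e i + e j) (e i + e j) = 2.
  rewrite /edot (eq_bigr (fun k => e i 0 k * (e i + e j) 0 k +
    e j 0 k * (e i + e j) 0 k)) => [|k _]; last first.
    by rewrite -mulrDl; congr (_ * _); rewrite mxE.
  rewrite big_split /= -/(edot _ _) -/(edot (e j) _) !edot_delta !mxE !eqxx.
  by rewrite (negPf ij) eq_sym (negPf ij) /= addr0 add0r.
rewrite scaleNr -[2]/(1 + 1) scalerDl scale1r opprD => E.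
apply/eqP; rewrite -addr_eq0.
apply/eqP; apply: (addrI (- s)); apply: (addIr (- s)).
by rewrite addr0 -E !addrA.
Qed.

(** The infinitesimal rotation in the plane of the i-th and j-th basis
    vectors. *)
Definition plane_mx (i j : 'I_n) : 'M[R]_n := delta_mx i j - delta_mx j i.

Lemma plane_mx_so i j : so_mx (plane_mx i j).
Proof. by rewrite /so_mx /plane_mx linearB /= !trmx_delta opprB. Qed.

Lemma plane_mx_vec i j k :
  so_vec (plane_mx i j) (e k) = (j == k)%:R *: e i - (i == k)%:R *: e j.
Proof.
rewrite /so_vec -rowE; apply/rowP=> l; rewrite !mxE eqxx /=.
by rewrite ![k == _]eq_sym -!natrM !mulnb ![_ && (_ == k)]andbC.
Qed.

Lemma spin_plane i j s : i != j ->
  spin_action rho (plane_mx i j) s = - (2^-1 *: rho (e i) (rho (e j) s)).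
Proof.
move=> ij; rewrite /spin_action; congr (- _).
have -> : \sum_k \sum_l plane_mx i j k l *: rho (e k) (rho (e l) s) =
   rho (e i) (rho (e j) s) - rho (e j) (rho (e i) s).
  have D p q : \sum_k \sum_l (delta_mx p q : 'M[R]_n) k l *:
      rho (e k) (rho (e l) s) = rho (e p) (rho (e q) s).
    rewrite (bigD1 p) //= (bigD1 q) //= mxE !eqxx scale1r.
    rewrite [X in _ + X + _]big1 ?addr0 => [|l /negPf lq]; last first.
      by rewrite mxE lq andbF scale0r.
    rewrite big1 ?addr0 // => k /negPf kp; rewrite big1 // => l _.
    by rewrite mxE kp scale0r.
  rewrite -!D -sumrB; apply: eq_bigr => k _.
  rewrite -sumrB; apply: eq_bigr => l _.
  by rewrite !mxE scalerBl.
rewrite (@rho_delta_anti j i) 1?eq_sym // opprK -mulr2n -scaler_nat.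
by rewrite scalerA; congr (_ *: _); field.
Qed.

Section Decomposition.
Variable f : 'rV[R]_n -> S -> S -> R.
Hypothesis f_bilin : forall v, bilinear_form (f v).
Hypothesis f_lin : forall s t, scalar (fun v => f v s t).
Hypothesis f_eqv : equivariant rho f.

Let r i j s := rho (e i) (rho (e j) s).

Let fD v w s t : f (v + w) s t = f v s t + f w s t.
Proof. by have := f_lin s t 1 v w; rewrite !(scale1r, mul1r). Qed.
Let f0 s t : f 0 s t = 0.
Proof. by apply: (addrI (f 0 s t)); rewrite -fD !addr0. Qed.
Let fZ a v s t : f (a *: v) s t = a * f v s t.
Proof. by have := f_lin s t a v 0; rewrite f0 !addr0. Qed.
Let fB v w s t : f (v - w) s t = f v s t - f w s t.
Proof. by rewrite fD -scaleN1r fZ mulN1r. Qed.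

(* Equivariance under the rotation of one coordinate plane. *)
Let f_plane i j k s t : i != j ->
  (j == k)%:R * f (e i) s t - (i == k)%:R * f (e j) s t =
  2^-1 * f (e k) (r i j s) t + 2^-1 * f (e k) s (r i j t).
Proof.
move=> ij; have := f_eqv (plane_mx_so i j) (e k) s t.
rewrite plane_mx_vec fB !fZ !spin_plane //.
rewrite (bilinNl (f_bilin _)) (bilinNr (f_bilin _)).
by rewrite (bilinZl (f_bilin _)) (bilinZr (f_bilin _)) !opprK.
Qed.

Let r_sqr i j s : i != j -> r i j (r i j s) = - s.
Proof.
move=> ij; rewrite /r (@rho_delta_anti j i) 1?eq_sym //.
by rewrite !rho_delta_sqr !rhoNr opprK rho_delta_sqr.
Qed.

Let f_move i j s t : i != j -> f (e i) (r i j s) t = f (e i) s (r i j t).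
Proof.
move=> ij.
have E1 u x : f (e i) u x = 2^-1 * f (e j) (r i j u) x + 2^-1 * f (e j) u (r i j x).
  by have := f_plane j u x ij; rewrite eqxx (negPf ij) mul0r mul1r subr0.
by rewrite !E1 !r_sqr // (bilinNl (f_bilin _)) (bilinNr (f_bilin _)) addrC.
Qed.

Let f_rot i j s t : i != j -> f (e j) s t = - f (e i) (r i j s) t.
Proof.
move=> ij; have ji : (j == i) = false by rewrite eq_sym (negPf ij).
have := f_plane i s t ij; rewrite eqxx ji mul0r mul1r sub0r f_move //; lra.
Qed.

Let g i s t := - f (e i) (rho (e i) s) t.

Let g_indep i j s t : g i s t = g j s t.
Proof.
case: (eqVneq i j) => [->//|ij]; rewrite /g [f (e j) _ _](f_rot _ _ ij).
by rewrite /r rho_delta_sqr rhoNr (bilinNl (f_bilin _)) opprK.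
Qed.

Let g_move i j s t : i != j -> g i (r i j s) t = - g i s (r i j t).
Proof.
move=> ij; rewrite /g opprK -f_move // /r.
rewrite rho_delta_sqr (@rho_delta_anti j i) 1?eq_sym //.
by rewrite rhoNr rho_delta_sqr opprK (bilinNl (f_bilin _)) opprK.
Qed.

Let g_rho i v s t : f v s t = g i (rho v s) t.
Proof.
rewrite [in RHS]rho_coord [v in LHS]row_sum_delta.
transitivity (\sum_k v 0 k * f (e k) s t).
  rewrite (big_morph (fun v => f v s t) (fun v w => fD v w s t) (f0 s t)).
  by apply: eq_bigr => k _; rewrite fZ.
have gb : bilinear_form (g i).
  split=> [x a u w|x a u w]; rewrite /g; last first.
    by rewrite (bilinDr (f_bilin _)) (bilinZr (f_bilin _)) opprD mulrN.
  by rewrite rhoDr rhoZr (bilinDl (f_bilin _)) (bilinZl (f_bilin _)) opprD mulrN.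
rewrite (bilin_suml gb); apply: eq_bigr => k _; rewrite (bilinZl gb).
by rewrite (g_indep i k) /g rho_delta_sqr (bilinNl (f_bilin _)) opprK.
Qed.

(** The summands are half of g(s, t) +- g(e_k s, e_k t), where
    g(s, t) = - f(e_i)(e_i s, t); neither depends on the choice of i and k. *)
Lemma equivariant_decomposition : (0 < n)%N ->
  exists bp bm, [/\ typed_form false bp, typed_form true bm &
    forall v s t, f v s t = bp (rho v s) t + bm (rho v s) t].
Proof.
move=> n_gt0; pose i0 := Ordinal n_gt0.
pose gT s t := g i0 (rho (e i0) s) (rho (e i0) t).
have gb : bilinear_form (g i0).
  split=> [x a u w|x a u w]; rewrite /g; last first.
    by rewrite (bilinDr (f_bilin _)) (bilinZr (f_bilin _)) opprD mulrN.
  by rewrite rhoDr rhoZr (bilinDl (f_bilin _)) (bilinZl (f_bilin _)) opprD mulrN.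
have gTb : bilinear_form gT.
  split=> [x a u w|x a u w]; rewrite /gT rhoDr rhoZr.
    by rewrite (bilinDl gb) (bilinZl gb).
  by rewrite (bilinDr gb) (bilinZr gb).
have g_even j s t : i0 != j -> g i0 (r i0 j s) (r i0 j t) = g i0 s t.
  by move=> ij; rewrite g_move // r_sqr // (bilinNr gb) opprK.
have gE k s t : g i0 (rho (e k) s) (rho (e k) t) = gT s t.
  case: (eqVneq i0 k) => [<-//|ik]; rewrite -(g_even k) // /r !rho_delta_sqr.
  by rewrite !rhoNr (bilinNl gb) (bilinNr gb) opprK.
have gTE k s t : gT (rho (e k) s) (rho (e k) t) = g i0 s t.
  by rewrite -(gE k) !rho_delta_sqr (bilinNl gb) (bilinNr gb) opprK.
have halfb x : bilinear_form (fun s t => 2^-1 * (g i0 s t + x * gT s t)).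
  split=> [y a u w|y a u w].
    by rewrite !(bilinDl gb) !(bilinZl gb) !(bilinDl gTb) !(bilinZl gTb); ring.
  by rewrite !(bilinDr gb) !(bilinZr gb) !(bilinDr gTb) !(bilinZr gTb); ring.
exists (fun s t => 2^-1 * (g i0 s t + 1 * gT s t)).
exists (fun s t => 2^-1 * (g i0 s t + (-1) * gT s t)).
split=> [||v s t]; [split=> // k s t..|]; rewrite ?gE ?gTE /=.
- by ring.
- by ring.
- by rewrite (g_rho i0); field.
Qed.
End Decomposition.

(** * The embeddings attached to admissible operators *)

Section Admissible.
Variable h : S -> S -> R.
Hypothesis hinv : invariant_inner_product rho h.

(** The isometries A of h with A^2 = (-1)^eps that commute (kap = false) or
    anticommute (kap = true) with Clifford multiplication. *)
Definition admissible_op (eps kap : bool) (A : S -> S) : Prop :=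
  [/\ linear A, forall s, A (A s) = (-1) ^+ eps *: s,
      forall s t, h (A s) (A t) = h s t &
      forall v s, A (rho v s) = (-1) ^+ kap *: rho v (A s)].

Lemma admissible_id : admissible_op false false id.
Proof. by split=> // *; rewrite expr0 scale1r. Qed.

Lemma admissible_comp eps kap A eps' kap' B (d : bool) :
  admissible_op eps kap A -> admissible_op eps' kap' B ->
  (forall s, A (B s) = (-1) ^+ d *: B (A s)) ->
  admissible_op (d (+) eps (+) eps') (kap (+) kap') (A \o B).
Proof.
move=> [linA AA hA rA] [linB BB hB rB] AB.
have [ZA ZB] := (linear_scale linA, linear_scale linB).
split=> [a u v|s|s t|v s] /=; rewrite ?linB ?linA //.
- by rewrite AB AA ZB BB !scalerA -!signr_addb.
- by rewrite hA hB.
- by rewrite rB ZA rA scalerA -signr_addb addbC.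
Qed.

(** Invariance is assumed for unit vectors only; it is used on basis vectors,
    and extends to all vectors by linearity in this form. *)
Lemma form_rho_skew v s t : h (rho v s) t = - h s (rho v t).
Proof.
case: hinv => hb _ _ hu.
have hk k (u w : S) : h (rho (e k) u) w = - h u (rho (e k) w).
  rewrite -(hu (e k)) ?edot_delta ?mxE ?eqxx // rho_delta_sqr.
  by rewrite (bilinNl hb).
rewrite !rho_coord (bilin_suml hb) (bilin_sumr hb) -sumrN.
by apply: eq_bigr => k _; rewrite (bilinZl hb) (bilinZr hb) hk mulrN.
Qed.

Lemma form_spin_skew M s t : so_mx M ->
  h (spin_action rho M s) t = - h s (spin_action rho M t).
Proof.
move=> soM; case: hinv => hb _ _ _; rewrite /spin_action.
rewrite (bilinNl hb) (bilinNr hb) (bilinZl hb) (bilinZr hb); congr (- _).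
rewrite -mulrN (bilin_suml hb) (bilin_sumr hb) -sumrN; congr (_ * _).
under eq_bigr do rewrite (bilin_suml hb).
under [RHS]eq_bigr do rewrite (bilin_sumr hb) -sumrN.
rewrite [RHS]exchange_big /=; apply: eq_bigr => i _; apply: eq_bigr => j _.
have -> : M j i = - M i j by have /matrixP/(_ i j) := soM; rewrite !mxE.
rewrite (bilinZl hb) (bilinZr hb) !form_rho_skew opprK.
by rewrite mulNr opprK.
Qed.

Lemma spin_action_op eps kap A M s : admissible_op eps kap A ->
  A (spin_action rho M s) = spin_action rho M (A s).
Proof.
move=> [linA _ _ rA].
have A0 : A 0 = 0 by have := linA (-1) 0 0; rewrite scaler0 addr0 scaleN1r addNr.
have ZA := linear_scale linA.
have DA (u w : S) : A (u + w) = A u + A w by have := linA 1 u w; rewrite !scale1r.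
rewrite /spin_action -scaleN1r ZA ZA scaleN1r; congr (- (_ *: _)).
rewrite (big_morph A DA A0); apply: eq_bigr => i _.
rewrite (big_morph A DA A0); apply: eq_bigr => j _.
rewrite ZA; congr (_ *: _).
by rewrite !rA rhoZr scalerA -expr2 sqrr_sign scale1r.
Qed.

(** Injectivity in v: if h(A (us), t) = 0 for all s and t, then us = 0, so
    - <u, u> s = 0 for all s. *)
Lemma jrho_embedding eps kap A : (exists s : S, s != 0) ->
  admissible_op eps kap A ->
  equivariant_embedding rho (jrho rho (form_op h A)).
Proof.
move=> [s0 s0_neq0] adm; have [linA AA hA rA] := adm.
have [hb hsym hpos hu] := hinv; have hAb := bilin_opl hb linA.
rewrite /jrho; split.
- move=> v; split=> [t a u w|s a u w]; last first.
    by rewrite (bilinDr hAb) (bilinZr hAb).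
  by rewrite rhoDr rhoZr (bilinDl hAb) (bilinZl hAb).
- move=> s t a u w.
  by rewrite rhoDl rhoZl (bilinDl hAb) (bilinZl hAb).
- move=> v w vw; apply/eqP; rewrite -subr_eq0; apply/eqP/edot_eq0.
  set u := v - w.
  have jz s t : form_op h A (rho u s) t = 0.
    rewrite rhoDl -scaleN1r rhoZl (bilinDl hAb) (bilinZl hAb) vw.
    by rewrite mulN1r subrr.
  have rz s : rho u s = 0.
    apply/eqP; apply: contraT => /hpos; rewrite -hA.
    by have := jz s (A (rho u s)); rewrite /form_op => ->; rewrite ltxx.
  have [_ _ cl] := cmod; have := cl u s0; rewrite !rz => /esym/eqP.
  by rewrite scaler_eq0 (negPf s0_neq0) orbF oppr_eq0 => /eqP.
- move=> M soM v s t; have [rL rR cl] := cmod.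
  rewrite -(spin_action_commutator v s rL rR cl soM) (bilinDl hAb).
  rewrite (bilinNl hAb (rho v _)) addrC; congr (_ + _).
  by rewrite /form_op (spin_action_op _ _ adm) form_spin_skew.
Qed.

(** Up to the signs of A, moving v and A across h exchanges s and t; h(vs, t) is
    itself skew, which accounts for the leading minus sign. *)
Lemma jrho_symmetry eps kap A v s t : admissible_op eps kap A ->
  jrho rho (form_op h A) v s t =
  - (-1) ^+ (eps (+) kap) * jrho rho (form_op h A) v t s.
Proof.
move=> [linA AA hA rA]; have [hb hsym hpos hu] := hinv.
rewrite /jrho /form_op -[LHS]hA AA (bilinZl hb) form_rho_skew.
have -> : rho v (A t) = (-1) ^+ kap *: A (rho v t).
  by rewrite rA scalerA -expr2 sqrr_sign scale1r.
by rewrite (bilinZr hb) hsym signr_addb; ring.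
Qed.

Lemma form_typed : typed_form false h.
Proof.
case: hinv => hb _ _ hu; split=> // k s t; rewrite mul1r.
by apply: hu; rewrite edot_delta mxE !eqxx.
Qed.

(** If the invariant forms are the multiples of h, one operator anticommuting
    with the action is enough to reach the forms of the other type. *)
Lemma jspan_multiples eps A : (0 < n)%N -> admissible_op eps true A ->
  (forall b, typed_form false b -> exists c, forall s t, b s t = c * h s t) ->
  forall f, equivariant_embedding rho f -> jspan rho h [:: id; A] f.
Proof.
move=> n_gt0 [linA AA hA rA] unique f [fb fl _ fe].
have [bp [bm [tp tm fE]]] := equivariant_decomposition fb fl fe n_gt0.
have [c cE] := unique _ tp.
have [d dE] := unique _ (typed_form_op linA rA tm).
exists (fun k => nth 0 [:: c; (-1) ^+ eps * d] k) => v s t.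
rewrite !big_ord_recl big_ord0 /= addr0 fE cE -mulrA -dE; congr (_ + _).
have [bmb _] := tm.
by rewrite /form_op AA (bilinZl bmb) mulrA -expr2 sqrr_sign mul1r.
Qed.

(** The same when the invariant forms are spanned by h_A for A in {1, I, Q, IQ},
    where Q = J if J anticommutes with E (o = true), and Q = E J if J commutes
    with E (o = false). *)
Lemma jspan_quaternionic (o : bool) (I J E : S -> S) : (0 < n)%N ->
  linear I -> admissible_op false true E ->
  (forall s, I (E s) = E (I s)) ->
  (forall s, J (E s) = (-1) ^+ o *: E (J s)) ->
  (forall b, typed_form false b -> exists x y z u, forall s t,
     let Q := if o then J s else E (J s) in
     b s t = x * h s t + y * h (I s) t + z * h Q t + u * h (I Q) t) ->
  forall f, equivariant_embedding rho f ->
  jspan rho h [:: id; I; J; I \o J; E; E \o I; E \o J; E \o (I \o J)] f.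
Proof.
move=> n_gt0 linI [linE EE _ rE] IE JE span f [fb fl _ fe].
have [bp [bm [tp tm fE]]] := equivariant_decomposition fb fl fe n_gt0.
have [x [y [z [u pE]]]] := span _ tp.
have [x' [y' [z' [u' mE]]]] := span _ (typed_form_op linE rE tm).
have [hb _ _ _] := hinv.
have bmE s t : bm s t = form_op bm E (E s) t.
  by rewrite /form_op EE expr0 scale1r.
have NI s t : h (I (- s)) t = - h (I s) t.
  exact: (bilinNl (bilin_opl hb linI)).
exists (fun k => nth 0 (if o
  then [:: x; y; z; u; x'; y'; - z'; - u']
  else [:: x; y; z'; u'; x'; y'; z; u]) k) => v s t.
rewrite !big_ord_recl big_ord0 addr0 fE bmE mE pE /jrho /form_op.
move: (rho v s) => r.
case: o JE {pE mE span} => JE; rewrite /= !JE ?expr1 ?scaleN1r ?scale1r.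
  by rewrite NI (bilinNl hb) !IE; ring.
by rewrite EE scale1r !IE; ring.
Qed.

(** For eigenvectors s, t of the parity operator E, with eigenvalues d, d', the
    invariance of h under E reads j_A(v)(s, t) = - (-1)^sig d d' j_A(v)(s, t). *)
Lemma jrho_parity E eps kap A (sig : bool) v s t (d d' : R) :
  admissible_op false true E -> admissible_op eps kap A ->
  (forall u, A (E u) = (-1) ^+ sig *: E (A u)) ->
  E s = d *: s -> E t = d' *: t -> (-1) ^+ sig * d * d' = 1 ->
  jrho rho (form_op h A) v s t = 0.
Proof.
move=> [linE EE hE rE] admA AE Es Et dd; have [linA AA hA rA] := admA.
have [hb _ _ _] := hinv; have hAb := bilin_opl hb linA.
have EA u : E (A u) = (-1) ^+ sig *: A (E u).
  by rewrite AE scalerA -expr2 sqrr_sign scale1r.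
suff : form_op h A (rho v s) t = - form_op h A (rho v s) t.
  by rewrite /jrho; lra.
rewrite -[in LHS]/(h (A (rho v s)) t) -[LHS]hE EA (bilinZl hb).
rewrite rE expr1 scaleN1r Es Et rhoZr (bilinZr hb).
rewrite -/(form_op h A _ _) (bilinNl hAb) (bilinZl hAb).
transitivity (- ((-1) ^+ sig * d * d' * form_op h A (rho v s) t)).
  by ring.
by rewrite dd mul1r.
Qed.

Section Parity.
Variables (E : S -> S) (Sp Sm : S -> Prop).
Hypothesis admE : admissible_op false true E.
Hypothesis Sp_E : forall s, Sp s -> E s = s.
Hypothesis Sm_E : forall s, Sm s -> E s = - s.
Hypothesis S_neq0 : exists s : S, s != 0.

Lemma jrho_isotropic eps kap A v : admissible_op eps kap A ->
    (forall s, A (E s) = E (A s)) ->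
  isotropic Sp (jrho rho (form_op h A) v) /\
  isotropic Sm (jrho rho (form_op h A) v).
Proof.
move=> admA AE; have AE' s : A (E s) = (-1) ^+ false *: E (A s).
  by rewrite AE scale1r.
split=> s t.
  move=> /Sp_E Es /Sp_E Et; apply: (jrho_parity (d := 1) (d' := 1) _ admE admA AE');
    by rewrite ?Es ?Et ?scale1r ?mulr1.
move=> /Sm_E Es /Sm_E Et; apply: (jrho_parity (d := -1) (d' := -1) _ admE admA AE');
  by rewrite ?Es ?Et ?scaleN1r // expr0 mul1r mulrNN mulr1.
Qed.

Lemma embeds_wedge_pm eps kap A : admissible_op eps kap A ->
    (forall s, A (E s) = E (A s)) -> eps = kap ->
  embeds_into rho (wedge_pm Sp Sm) (jrho rho (form_op h A)).
Proof.
move=> admA AE ek; split=> [|v]; first exact: jrho_embedding admA.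
have [iso_p iso_m] := jrho_isotropic v admA AE; split=> // s t.
by rewrite (jrho_symmetry v s t admA) ek addbb expr0 mulN1r.
Qed.

Lemma embeds_vee_pm eps kap A : admissible_op eps kap A ->
    (forall s, A (E s) = E (A s)) -> eps = ~~ kap ->
  embeds_into rho (vee_pm Sp Sm) (jrho rho (form_op h A)).
Proof.
move=> admA AE ek; split=> [|v]; first exact: jrho_embedding admA.
have [iso_p iso_m] := jrho_isotropic v admA AE; split=> // s t.
by rewrite (jrho_symmetry v s t admA) ek addNb addbb expr1 opprK mul1r.
Qed.

Lemma embeds_vee2_sum eps kap A : admissible_op eps kap A ->
    (forall s, A (E s) = - E (A s)) -> eps = ~~ kap ->
  embeds_into rho (vee2_sum Sp Sm) (jrho rho (form_op h A)).
Proof.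
move=> admA AE ek; split=> [|v]; first exact: jrho_embedding admA.
split=> [s t|s t /Sp_E Es /Sm_E Et].
  by rewrite (jrho_symmetry v s t admA) ek addNb addbb expr1 opprK mul1r.
have AE' u : A (E u) = (-1) ^+ true *: E (A u) by rewrite AE expr1 scaleN1r.
apply: (jrho_parity (d := 1) (d' := -1) _ admE admA AE').
- by rewrite Es scale1r.
- by rewrite Et scaleN1r.
- by rewrite expr1 mulr1 mulrNN mulr1.
Qed.

End Parity.
End Admissible.
End CliffordModule.

(** * The Clifford algebra on the basis of ordered monomials *)

Section CliffordTheory.
Variables (F : comNzRingType) (m : nat).
Implicit Types (A B C : {set 'I_m}) (x y : clifford F m).

Lemma sign_symdiff A B :
  (-1) ^+ #|symdiff A B| = (-1) ^+ #|A| * (-1) ^+ #|B| :> F.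
Proof.
have E (X : {set _}) : (-1) ^+ #|X| = \prod_(i < m) (-1) ^+ (i \in X) :> F.
  rewrite prodrXr; congr (_ ^+ _); rewrite -sum1_card big_mkcond.
  by apply: eq_bigr => i _; case: ifP.
rewrite !E -big_split; apply: eq_bigr => i _; rewrite !inE /=.
exact: signr_addb.
Qed.

Lemma csign_comm A B :
  csign F A B * csign F B A = (-1) ^+ (#|A| * #|B| + #|A :&: B|).
Proof.
rewrite /csign -exprD; congr (_ ^+ _).
rewrite -cardsX.
set X := [set p in setX A B | _]; set Y := [set p in setX B A | _].
have -> : #|Y| = #|[set p in setX A B | (p.1 <= p.2)%N]|.
  pose sw (p : 'I_m * 'I_m) := (p.2, p.1).
  have swK : involutive sw by case.
  rewrite -(card_imset _ (can_inj swK)); apply: eq_card => p.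
  rewrite -[p]swK (mem_imset _ _ (can_inj swK)) !inE.
  by case: p => k l /=; rewrite [(k \in _) && _]andbC.
rewrite -cardsUI; congr (_ + _)%N.
  apply: eq_card => -[k l]; rewrite !inE /= -andb_orr.
  by case: ltngtP => _; rewrite /= ?andbT.
pose diag (k : 'I_m) := (k, k).
have diag_inj : injective diag by move=> k l [].
rewrite -(card_imset _ diag_inj); apply: eq_card => -[k l].
apply/idP/imsetP => [|[x]]; rewrite !inE /=.
  case/andP=> /andP[/andP[kA lB] lk] /andP[_ kl].
  have kl' : k = l by apply/val_inj/eqP; rewrite eqn_leq kl lk.
  by exists k; rewrite ?inE ?kA /diag kl' // lB andbT -kl'.
by case/andP=> xA xB [-> ->]; rewrite xA xB leqnn.
Qed.

Lemma cbasisC A B : cbasis F A * cbasis F B =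
  (-1) ^+ (#|A| * #|B| + #|A :&: B|) *: (cbasis F B * cbasis F A).
Proof.
rewrite !cbasisM scalerA -csign_comm -mulrA csign_sqr mulr1.
by rewrite symdiffC.
Qed.

Lemma cbasis_expand x : x = \sum_A x A *: cbasis F A.
Proof.
apply/ffunP=> C; rewrite sum_ffunE (bigD1 C) //= big1 ?addr0 => [|A /negPf AC].
  by rewrite !ffunE eqxx [RHS]mulr1.
by rewrite !ffunE AC [LHS]mulr0.
Qed.

Lemma cbasisMlE A x C :
  (cbasis F A * x) C = csign F A (symdiff A C) * x (symdiff A C).
Proof.
rewrite ffunE (bigD1 A) //= big1 ?addr0 => [|B /negPf BA].
  by rewrite ffunE eqxx mul1r.
by rewrite ffunE eq_sym BA mul0r mulr0.
Qed.

Lemma calpha_cbasis A : calpha (cbasis F A) = (-1) ^+ #|A| *: cbasis F A.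
Proof.
apply/ffunP=> C; rewrite !ffunE; case: (A =P C) => [->//|_].
by rewrite mulr0 [RHS]mulr0.
Qed.

Lemma calpha_linear : linear (@calpha F m).
Proof.
move=> a x y; apply/ffunP=> C; rewrite !ffunE /GRing.scale /= mulrDr.
by congr (_ + _); exact: mulrCA.
Qed.

Lemma calphaK : involutive (@calpha F m).
Proof.
by move=> x; apply/ffunP=> C; rewrite !ffunE mulrA -expr2 sqrr_sign mul1r.
Qed.

Lemma calphaM x y : calpha (x * y) = calpha x * calpha y.
Proof.
apply/ffunP=> C; rewrite !ffunE mulr_sumr; apply: eq_bigr => A _.
rewrite !ffunE; set B := symdiff A C.
have -> : (-1) ^+ #|C| = (-1) ^+ #|A| * (-1) ^+ #|B| :> F.
  by rewrite -sign_symdiff symdiffK.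
ring.
Qed.

Lemma calpha_cgen (i : 'I_m) : calpha (cgen F i) = - cgen F i.
Proof. by rewrite calpha_cbasis cards1 expr1 scaleN1r. Qed.

Lemma calphaD x y : calpha (x + y) = calpha x + calpha y.
Proof. by have := calpha_linear 1 x y; rewrite !scale1r. Qed.

Lemma calphaZ (a : F) x : calpha (a *: x) = a *: calpha x.
Proof. by apply/ffunP=> C; rewrite !ffunE; exact: mulrCA. Qed.

Lemma calphaN x : calpha (- x) = - calpha x.
Proof. by rewrite -scaleN1r calphaZ scaleN1r. Qed.

Lemma calpha_sum I (r : seq I) (P : pred I) (G : I -> clifford F m) :
  calpha (\sum_(i <- r | P i) G i) = \sum_(i <- r | P i) calpha (G i).
Proof.
apply: big_morph; first exact: calphaD.
by apply/ffunP=> C; rewrite !ffunE mulr0.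
Qed.

Lemma calpha_cvec v : calpha (cvec v) = - cvec v :> clifford F m.
Proof.
rewrite calpha_sum -sumrN; apply: eq_bigr => i _.
by rewrite calphaZ calpha_cgen scalerN.
Qed.

Lemma cvolE : cvol F m = cbasis F setT.
Proof. by rewrite cbasis_prod; apply: eq_bigl => i; rewrite inE. Qed.

(** The number of pairs j <= i in {0, ..., m-1} is C(m+1, 2). *)
Lemma cvol_sqr : cvol F m * cvol F m = (-1) ^+ 'C(m.+1, 2).
Proof.
rewrite cvolE cbasisM symdiffxx csignE.
have -> : \prod_(i < m) \prod_(j < m) (-1) ^+
    ((i \in setT) && (j \in setT) && (j <= i)%N) = (-1) ^+ 'C(m.+1, 2) :> F.
  rewrite -bin2_sum big_nat_recl // add0n big_mkord -prodrXr.
  apply: eq_bigr => i _; rewrite prodrXr; congr (_ ^+ _).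
  under eq_bigr do rewrite !inE /=.
  rewrite -(big_mkord xpredT (fun j => nat_of_bool (j <= i)%N)).
  rewrite (big_cat_nat (n := i.+1)) //= [X in (_ + X)%N]big_nat.
  rewrite [X in (_ + X)%N]big1 => [|j /andP[ij _]]; last first.
    by rewrite leqNgt ij.
  rewrite addn0 big_nat (eq_bigr (fun=> 1%N)) => [|j /andP[_ ji]]; last first.
    by rewrite -ltnS ji.
  by rewrite -big_nat sum_nat_const_nat muln1 subn0.
rewrite -(signr_odd F) -(signr_odd (clifford F m)).
by case: (odd _); rewrite ?scaleN1r ?scale1r.
Qed.

(** Left multiplication by w is right multiplication by w composed with
    alpha^(m-1). *)
Lemma cvolM x :
  cvol F m * x = (if odd m then x else calpha x) * cvol F m.
Proof.
have basis A : cvol F m * cbasis F A =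
    (if odd m then cbasis F A else calpha (cbasis F A)) * cvol F m.
  rewrite cvolE cbasisC setTI cardsT card_ord -mulSnr scalerAl.
  rewrite -signr_odd oddM /= calpha_cbasis.
  by case: (odd m); rewrite /= ?scale1r // signr_odd.
rewrite [x in LHS]cbasis_expand [x in RHS]cbasis_expand mulr_sumr.
case: (odd m) basis => basis.
  by rewrite mulr_suml; apply: eq_bigr => A _; rewrite -scalerAr basis scalerAl.
rewrite calpha_sum mulr_suml; apply: eq_bigr => A _.
by rewrite -scalerAr basis calphaZ scalerAl.
Qed.

Lemma ceven_alpha x : ceven x -> calpha x = x.
Proof.
move=> x_even; apply/ffunP=> A; rewrite ffunE -signr_odd.
by case: (boolP (odd _)) => [/x_even ->|_]; rewrite ?mulr0 ?mul1r.
Qed.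

Lemma codd_alpha x : codd x -> calpha x = - x.
Proof.
move=> x_odd; apply/ffunP=> A; rewrite !ffunE -signr_odd.
case: (boolP (odd _)) => [_|/x_odd ->]; rewrite ?expr1 ?mulN1r // mulr0.
by rewrite oppr0.
Qed.

Lemma calpha_cvol : calpha (cvol F m) = (-1) ^+ m *: cvol F m.
Proof. by rewrite cvolE calpha_cbasis cardsT card_ord. Qed.

End CliffordTheory.

Section CliffordForm.
Variables (F : numDomainType) (m : nat).
Variable b : clifford F m -> clifford F m -> F.
Hypothesis bb : (forall t, scalar (b^~ t)) /\ (forall s, scalar (b s)).

Lemma clifford_form_cbasisl A s t :
    (forall i s t, b (cgen F i * s) (cgen F i * t) = b s t) ->
  b (cbasis F A * s) (cbasis F A * t) = b s t.
Proof.
move=> bl; rewrite cbasis_prod; move: s t.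
apply: (big_ind (fun x => forall s t, b (x * s) (x * t) = b s t)) => //.
  by move=> s t; rewrite !mul1r.
by move=> x y bx by_ s t; rewrite -!mulrA bx by_.
Qed.

Lemma clifford_form_cbasisr A s t :
    (forall i s t, b (s * cgen F i) (t * cgen F i) = b s t) ->
  b (s * cbasis F A) (t * cbasis F A) = b s t.
Proof.
move=> br; rewrite cbasis_prod; move: s t.
apply: (big_ind (fun x => forall s t, b (s * x) (t * x) = b s t)) => //.
  by move=> s t; rewrite !mulr1.
by move=> x y bx by_ s t; rewrite !mulrA by_ bx.
Qed.

(** The key uniqueness statement; over the complex numbers it is applied to the
    bilinear form obtained from a sesquilinear one. *)
Lemma clifford_form_unique :
    (forall i s t, b (cgen F i * s) (cgen F i * t) = b s t) ->
    (forall i s t, b (calpha s * cgen F i) (calpha t * cgen F i) = b s t) ->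
  forall s t, b s t = b 1 1 * \sum_A s A * t A.
Proof.
move=> bl br.
have bA A s t := clifford_form_cbasisl A s t bl.
have b1 C : C != set0 -> b 1 (cbasis F C) = 0.
  case/set0Pn=> i iC; apply/eqP; rewrite -eqNr -(bilinNl bb); apply/eqP.
  (* e_i alpha(1) e_i = -1, whereas e_i alpha(e_C) e_i = e_C as i is in C. *)
  rewrite -[RHS](br i) -[RHS](bl i); congr (b _ _).
    rewrite (calpha_cbasis _ set0 : calpha 1 = _) cards0 expr0 scale1r mul1r.
    by rewrite cgen_sqr.
  rewrite calpha_cbasis -scalerAl -scalerAr cbasisC cards1 muln1.
  have -> : C :&: [set i] = [set i] by apply/setIidPr; rewrite sub1set.
  rewrite -scalerAr cards1 mulrA cgen_sqr mulN1r !scalerN scalerA exprD.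
  by rewrite mulrA -expr2 sqrr_sign mul1r expr1 scaleN1r opprK.
have bAB A B : b (cbasis F A) (cbasis F B) = (A == B)%:R * b 1 1.
  case: (A =P B) => [<-|AB].
    by rewrite mul1r -[in RHS](bA A) !mulr1.
  rewrite mul0r -(bA A) !cbasisM symdiffxx (bilinZl bb) (bilinZr bb) b1 ?mulr0 //.
  apply/eqP=> AB0; apply: AB.
  by rewrite -[RHS](symdiffK A) AB0 symdiff0.
move=> s t; rewrite [s in LHS]cbasis_expand [t in LHS]cbasis_expand.
rewrite (bilin_suml bb) mulr_sumr; apply: eq_bigr => A _.
rewrite (bilinZl bb) (bilin_sumr bb) (bigD1 A) //= big1 ?addr0 => [|B BA].
  by rewrite (bilinZr bb) bAB eqxx mul1r; ring.
by rewrite (bilinZr bb) bAB eq_sym (negPf BA) mul0r mulr0.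
Qed.
End CliffordForm.

(** * The two halves of R^m + R^m *)

Lemma edot_halves (F : comNzRingType) m (v : 'rV[F]_(m + m)) :
  edot v v = edot (lsubmx v) (lsubmx v) + edot (rsubmx v) (rsubmx v).
Proof.
rewrite /edot big_split_ord; congr (_ + _); apply: eq_bigr => i _.
  by rewrite !mxE.
by rewrite !mxE.
Qed.

Lemma cvec_linear (F : comNzRingType) m : linear (@cvec F m).
Proof.
move=> a u v; rewrite /cvec scaler_sumr -big_split; apply: eq_bigr => i _ /=.
by rewrite !mxE scalerDl scalerA.
Qed.

Lemma cvec0 (F : comNzRingType) m : cvec 0 = 0 :> clifford F m.
Proof. by rewrite /cvec big1 // => i _; rewrite mxE scale0r. Qed.

Lemma cvec_delta (F : comNzRingType) m i :
  cvec (delta_mx 0 i) = cgen F i :> clifford F m.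
Proof.
rewrite /cvec (bigD1 i) //= big1 ?addr0 => [|j /negPf ji].
  by rewrite mxE !eqxx scale1r.
by rewrite mxE ji andbF scale0r.
Qed.

Lemma lsubmx_delta_l (R : nzRingType) p q i :
  lsubmx (delta_mx 0 (lshift q i)) = delta_mx 0 i :> 'rV[R]_p.
Proof. by apply/rowP=> j; rewrite !mxE (inj_eq (@lshift_inj _ _)). Qed.

Lemma rsubmx_delta_l (R : nzRingType) p q (i : 'I_p) :
  rsubmx (delta_mx 0 (lshift q i)) = 0 :> 'rV[R]_q.
Proof. by apply/rowP=> j; rewrite !mxE eq_rlshift. Qed.

Lemma lsubmx_delta_r (R : nzRingType) p q (i : 'I_q) :
  lsubmx (delta_mx 0 (rshift p i)) = 0 :> 'rV[R]_p.
Proof. by apply/rowP=> j; rewrite !mxE eq_lrshift. Qed.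

Lemma rsubmx_delta_r (R : nzRingType) p q i :
  rsubmx (delta_mx 0 (rshift p i)) = delta_mx 0 i :> 'rV[R]_q.
Proof. by apply/rowP=> j; rewrite !mxE (inj_eq (@rshift_inj _ _)). Qed.

Definition delta_halves :=
  (lsubmx_delta_l, rsubmx_delta_l, lsubmx_delta_r, rsubmx_delta_r).

Lemma odd_bin2S m : odd 'C(m.+1, 2) = (m %% 4 \in [:: 1; 2])%N.
Proof.
have C2 : ('C(m.+1, 2) * 2 = m.+1 * m)%N.
  by rewrite bin2 muln2 -[RHS]odd_double_half oddM /= andNb.
have mE := divn_eq m 4; have : (m %% 4 < 4)%N by rewrite ltn_mod.
move: mE C2; move: 'C(_, _) (m %/ 4)%N (m %% 4)%N => x q.
case=> [|[|[|[|//]]]] mE C2 _; rewrite mE in C2.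
- have -> : (x = ((4 * q + 1) * q).*2)%N by nia.
  by rewrite odd_double.
- have -> : (x = ((q * (4 * q + 3)).*2).+1)%N by nia.
  by rewrite /= odd_double.
- have -> : (x = ((q * (4 * q + 5)).*2).+3)%N by nia.
  by rewrite /= odd_double.
- have -> : (x = ((q + 1) * (4 * q + 3)).*2)%N by nia.
  by rewrite odd_double.
Qed.

(** * The real models *)

Section RealModels.
Variables (R : realType) (m : nat).
Local Notation Cl := (clifford R m).
Local Notation w := (cvol R m).

(** The scalar product of the real Clifford algebra for which the e_A are
    orthonormal. *)
Definition cdot (s t : Cl) : R := \sum_A s A * t A.

Lemma cdot_alpha s t : cdot (calpha s) (calpha t) = cdot s t.
Proof.
by apply: eq_bigr => A _; rewrite !ffunE mulrACA -expr2 sqrr_sign mul1r.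
Qed.

Section Mod0.
Hypothesis m0 : (m %% 4 = 0)%N.
Local Notation rho := (@rho_0mod4 R m).

Let m_even : odd m = false.
Proof. by rewrite (divn_eq m 4) m0 addn0 oddM andbF. Qed.

Let w_sqr : w * w = 1.
Proof. by rewrite cvol_sqr -signr_odd odd_bin2S m0. Qed.

Let w_comm x : w * x = calpha x * w.
Proof. by rewrite cvolM m_even. Qed.

Lemma rho0_module : clifford_module rho.
Proof.
rewrite /rho_0mod4; split=> [u a v v'|v a u u'|v u].
- rewrite !linearP /= !cvec_linear !(mulrDl, mulrDr) scalerDr.
  by rewrite -!scalerAl -!scalerAr addrACA.
- rewrite !(mulrDl, mulrDr) scalerDr.
  by rewrite -!scalerAr -!scalerAl addrACA.
- set x := cvec _; set y := cvec _.
  have xx : x * x = - (edot (lsubmx v) (lsubmx v))%:A by exact: cvec_sqr.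
  have yy : y * y = - (edot (rsubmx v) (rsubmx v))%:A by exact: cvec_sqr.
  have wx : w * x = - (x * w) by rewrite w_comm calpha_cvec mulNr.
  rewrite !(mulrDr, mulrDl) edot_halves !mulrA wx xx.
  rewrite w_sqr mul1r -!mulrA yy opprD scalerDl !mulrN !mulNr !scaleNr.
  by rewrite mulr_algl mulr_algr !mulrA addrA addrK.
Qed.

Lemma rho0_left i s : rho (delta_mx 0 (lshift m i)) s = cgen R i * s.
Proof. by rewrite /rho_0mod4 !delta_halves cvec_delta cvec0 mulr0 addr0. Qed.

Lemma rho0_right i s : rho (delta_mx 0 (rshift m i)) s = w * s * cgen R i.
Proof. by rewrite /rho_0mod4 !delta_halves cvec_delta cvec0 mul0r add0r. Qed.

(** For m even alpha is conjugation by w, so invariance under the right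
    multiplications s |-> s e_i gives invariance under alpha, as required by
    clifford_form_unique. *)
Lemma rho0_form_unique b : typed_form rho false b ->
  forall s t, b s t = b 1 1 * cdot s t.
Proof.
move=> [bb bt]; have bl i s t : b (cgen R i * s) (cgen R i * t) = b s t.
  by rewrite -!rho0_left bt mul1r.
have bw s t : b (w * s) (w * t) = b s t by rewrite cvolE clifford_form_cbasisl.
have br i s t : b (s * cgen R i) (t * cgen R i) = b s t.
  by rewrite -bw !mulrA -!rho0_right bt mul1r.
apply: clifford_form_unique => // i s t; rewrite br.
rewrite -[LHS](@clifford_form_cbasisr _ _ b setT) //.
by rewrite -cvolE -!w_comm bw.
Qed.

Lemma rho0_alpha v s : calpha (rho v s) = - rho v (calpha s).
Proof.
rewrite /rho_0mod4 calphaD !calphaM !calpha_cvec calpha_cvol.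
by rewrite -signr_odd m_even scale1r mulNr mulrN opprD.
Qed.

Section Forms.
Variable h : Cl -> Cl -> R.
Hypothesis hinv : invariant_inner_product rho h.
Hypothesis m_gt0 : (0 < m)%N.

Let hE s t : h s t = h 1 1 * cdot s t.
Proof. exact: rho0_form_unique (form_typed hinv) s t. Qed.

Let h11 : h 1 1 != 0.
Proof. by case: hinv => _ _ hpos _; rewrite gt_eqF // hpos // oner_eq0. Qed.

Lemma alpha_admissible : admissible_op rho h false true (@calpha R m).
Proof.
split=> [|s|s t|v s]; first exact: calpha_linear.
- by rewrite calphaK scale1r.
- by rewrite [LHS]hE [RHS]hE cdot_alpha.
- by rewrite rho0_alpha expr1 scaleN1r.
Qed.

Lemma rho0_span f : equivariant_embedding rho f ->
  jspan rho h [:: id; @calpha R m] f.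
Proof.
move: f; apply: (jspan_multiples rho0_module _ alpha_admissible).
  by rewrite addn_gt0 m_gt0.
move=> b bt; exists (b 1 1 / h 1 1) => s t.
by rewrite [h s t]hE mulrA divfK // (rho0_form_unique bt).
Qed.

End Forms.
End Mod0.

Section Mod3.
Hypothesis m3 : (m %% 4 = 3)%N.
Local Notation rho := (@rho_3mod4 R m).

Let m_odd : odd m = true.
Proof. by rewrite (divn_eq m 4) m3 oddD oddM andbF. Qed.

Let w_sqr : w * w = 1.
Proof. by rewrite cvol_sqr -signr_odd odd_bin2S m3. Qed.

Let w_comm x : w * x = x * w.
Proof. by rewrite cvolM m_odd. Qed.

Let alpha_w : calpha w = - w.
Proof. by rewrite calpha_cvol -signr_odd m_odd expr1 scaleN1r. Qed.

Lemma rho3_module : clifford_module rho.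
Proof.
rewrite /rho_3mod4; split=> [u a v v'|v a u u'|v u].
- rewrite !linearP /= !cvec_linear !(mulrDl, mulrDr) scalerDr.
  by rewrite -!scalerAl -!scalerAr addrACA.
- rewrite calpha_linear !(mulrDl, mulrDr) scalerDr.
  by rewrite -!scalerAr -!scalerAl addrACA.
- set x := cvec _; set y := cvec _.
  have xx : x * x = - (edot (lsubmx v) (lsubmx v))%:A by exact: cvec_sqr.
  have yy : y * y = - (edot (rsubmx v) (rsubmx v))%:A by exact: cvec_sqr.
  rewrite calphaD !calphaM !calpha_cvec calphaK alpha_w.
  rewrite !(mulrDr, mulrDl) edot_halves !mulrA !(mulrN, mulNr) opprK xx.
  rewrite w_sqr mul1r -!mulrA yy opprD scalerDl !mulrN !mulNr !scaleNr.
  rewrite [x * (w * _)]mulrA -w_comm -!mulrA.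
  by rewrite mulr_algl mulr_algr !mulrA addrA addrK.
Qed.

Lemma rho3_left i s : rho (delta_mx 0 (lshift m i)) s = cgen R i * s.
Proof. by rewrite /rho_3mod4 !delta_halves cvec_delta cvec0 mulr0 addr0. Qed.

Lemma rho3_right i s : rho (delta_mx 0 (rshift m i)) s = w * calpha s * cgen R i.
Proof. by rewrite /rho_3mod4 !delta_halves cvec_delta cvec0 mul0r add0r. Qed.

Lemma rho3_form_unique b : typed_form rho false b ->
  forall s t, b s t = b 1 1 * cdot s t.
Proof.
move=> [bb bt]; have bl i s t : b (cgen R i * s) (cgen R i * t) = b s t.
  by rewrite -!rho3_left bt mul1r.
have bw s t : b (w * s) (w * t) = b s t by rewrite cvolE clifford_form_cbasisl.
apply: clifford_form_unique => // i s t.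
by rewrite -bw !mulrA -!rho3_right bt mul1r.
Qed.

Lemma rho3_J v (s : Cl) : opJ3 (rho v s) = - rho v (opJ3 s).
Proof.
rewrite /rho_3mod4 /opJ3 calphaD !calphaM !calpha_cvec alpha_w calphaK.
rewrite !(mulrDr, mulrDl) !(mulrN, mulNr) !mulrA opprD !opprK.
by rewrite [w * cvec (lsubmx v)]w_comm.
Qed.

Lemma opJ3_sqr (s : Cl) : opJ3 (opJ3 s) = - s.
Proof. by rewrite /opJ3 calphaM alpha_w calphaK mulrA mulrN mulNr w_sqr mul1r. Qed.

Lemma opJ3_linear : linear (@opJ3 R m).
Proof. by move=> a u v; rewrite /opJ3 calpha_linear mulrDr scalerAr. Qed.

Section Forms.
Variable h : Cl -> Cl -> R.
Hypothesis hinv : invariant_inner_product rho h.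
Hypothesis m_gt0 : (0 < m)%N.

Let hE s t : h s t = h 1 1 * cdot s t.
Proof. exact: rho3_form_unique (form_typed hinv) s t. Qed.

Let h11 : h 1 1 != 0.
Proof. by case: hinv => _ _ hpos _; rewrite gt_eqF // hpos // oner_eq0. Qed.

Lemma J3_admissible : admissible_op rho h true true (@opJ3 R m).
Proof.
split=> [|s|s t|v s]; first exact: opJ3_linear.
- by rewrite opJ3_sqr expr1 scaleN1r.
- have [hb _ _ _] := hinv.
  rewrite /opJ3 cvolE clifford_form_cbasisl => [|i u u'].
    by rewrite [LHS]hE [RHS]hE cdot_alpha.
  by have [_ ht] := form_typed hinv; rewrite -!rho3_left ht mul1r.
- by rewrite rho3_J expr1 scaleN1r.
Qed.

Lemma rho3_span f : equivariant_embedding rho f ->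
  jspan rho h [:: id; @opJ3 R m] f.
Proof.
move: f; apply: (jspan_multiples rho3_module _ J3_admissible).
  by rewrite addn_gt0 m_gt0.
move=> b bt; exists (b 1 1 / h 1 1) => s t.
by rewrite [h s t]hE mulrA divfK // (rho3_form_unique bt).
Qed.

End Forms.
End Mod3.
End RealModels.

(** * The complex model *)

Section ComplexModel.
Variables (R : realType) (m : nat).
Local Notation C := R[i].
Local Notation Cl := (clifford C m).
Local Notation S := (cclifford R m).
Local Notation w := (cvol C m).
Local Notation rho := (@rho_12mod4 R m).
Local Notation ii := ('i%C : C).
Hypothesis m12 : (m %% 4 = 1)%N \/ (m %% 4 = 2)%N.

(** Real scalar multiplication on the realified algebra. *)
Lemma rscaleE (a : R) (s : S) : a *: s = (real_complex R a *: (s : Cl)) :> Cl.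
Proof. by []. Qed.

Lemma ii_sqr : ii * ii = -1.
Proof. by rewrite -expr2 sqr_i. Qed.

Lemma conjcM (x y : C) : conjc (x * y) = conjc x * conjc y.
Proof. exact: rmorphM. Qed.

Lemma conjc_sign k : conjc ((-1) ^+ k) = (-1) ^+ k :> C.
Proof. exact: rmorph_sign. Qed.

Lemma conjc_sum I (r : seq I) (P : pred I) (G : I -> C) :
  conjc (\sum_(i <- r | P i) G i) = \sum_(i <- r | P i) conjc (G i).
Proof. exact: rmorph_sum. Qed.

Lemma conjc_ii : conjc ii = - ii.
Proof. by apply/eqP; rewrite eq_complex /= oppr0 !eqxx. Qed.

Lemma Re_conjc (x : C) : complex.Re (conjc x) = complex.Re x.
Proof. by case: x. Qed.

Lemma cconjD (s t : Cl) : cconj (s + t) = cconj s + cconj t.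
Proof. by apply/ffunP=> A; rewrite !ffunE; exact: rmorphD. Qed.

Lemma cconjZ (a : C) (s : Cl) : cconj (a *: s) = conjc a *: cconj s.
Proof. by apply/ffunP=> A; rewrite !ffunE; exact: rmorphM. Qed.

Lemma cconjM (s t : Cl) : cconj (s * t) = cconj s * cconj t.
Proof.
apply/ffunP=> A; rewrite !ffunE.
rewrite conjc_sum; apply: eq_bigr => B _.
rewrite !ffunE conjcM conjcM; congr (_ * _).
exact: conjc_sign.
Qed.

Lemma cconjK : involutive (@cconj R m).
Proof. by move=> s; apply/ffunP=> A; rewrite !ffunE conjcK. Qed.

Lemma cconj_alpha (s : Cl) : cconj (calpha s) = calpha (cconj s).
Proof.
apply/ffunP=> A; rewrite !ffunE conjcM; congr (_ * _).
exact: conjc_sign.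
Qed.

Lemma cconj_cbasis A : cconj (cbasis C A) = cbasis C A :> Cl.
Proof. by apply/ffunP=> B; rewrite !ffunE rmorph_nat. Qed.

Lemma cconj_cvec x : cconj (cvecC x) = cvecC x :> Cl.
Proof.
apply/ffunP=> A; rewrite /cvecC /cvec ffunE !sum_ffunE conjc_sum.
apply: eq_bigr => i _; rewrite !ffunE conjcM rmorph_nat mxE.
by congr (_ * _); rewrite /= oppr0.
Qed.

Lemma cconj_vol : cconj w = w.
Proof. by rewrite cvolE cconj_cbasis. Qed.

Let w_sqr : w * w = -1.
Proof. by rewrite cvol_sqr -signr_odd odd_bin2S; case: m12 => ->. Qed.

Let w_comm x : w * x = (if odd m then x else calpha x) * w.
Proof. exact: cvolM. Qed.

Let alpha_w : calpha w = (-1) ^+ odd m *: w.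
Proof. by rewrite calpha_cvol signr_odd. Qed.

Lemma cvecC_linear a (u v : 'rV[R]_m) :
  cvecC (a *: u + v) = real_complex R a *: cvecC u + cvecC v.
Proof. by rewrite /cvecC map_mxD map_mxZ cvec_linear. Qed.

Lemma cvecC_sqr (v : 'rV[R]_m) :
  cvecC v * cvecC v = - real_complex R (edot v v) *: 1.
Proof.
rewrite cvec_sqr -scaleNr; congr (- _ *: _); rewrite /edot rmorph_sum.
by apply: eq_bigr => i _; rewrite !mxE rmorphM.
Qed.

Lemma rho12_module : clifford_module rho.
Proof.
split=> [u a v v'|v a u u'|v u].
- rewrite rscaleE /rho_12mod4 !linearP !cvecC_linear !(mulrDl, mulrDr).
  rewrite !scalerDr !scalerA -!scalerAl -!scalerAr !scalerA.
  by rewrite addrACA [ii * _]mulrC.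
- rewrite !rscaleE /rho_12mod4 calpha_linear !(mulrDl, mulrDr) !scalerDr.
  rewrite -!scalerAr -!scalerAl !scalerA [ii * _]mulrC.
  by rewrite -!addrA; congr (_ + _); rewrite addrCA.
- have [xx yy] := (cvecC_sqr (lsubmx v), cvecC_sqr (rsubmx v)).
  have ax : calpha (cvecC (lsubmx v)) = - cvecC (lsubmx v) by exact: calpha_cvec.
  have ay : calpha (cvecC (rsubmx v)) = - cvecC (rsubmx v) by exact: calpha_cvec.
  rewrite rscaleE edot_halves rmorphN rmorphD /rho_12mod4.
  move: (cvecC _) (cvecC (rsubmx v)) xx yy ax ay => x y xx yy ax ay.
  rewrite calphaD calphaZ !calphaM calphaK ax ay.
  rewrite (mulrDr x) (mulrDl _ _ y) scalerDr -scalerAl -scalerAr scalerA ii_sqr.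
  rewrite scaleN1r !(mulrN, mulNr) opprK -(mulrA u) yy mulrA xx.
  rewrite opprD scalerDl -scalerAl -scalerAr mul1r mulr1.
  by rewrite scalerN -addrA; congr (_ + _); rewrite mulrA addrA subrr add0r.
Qed.

Lemma rho12_left i (s : S) : rho (delta_mx 0 (lshift m i)) s = cgen C i * (s : Cl).
Proof.
rewrite /rho_12mod4 !delta_halves /cvecC map_mx0 cvec0 mulr0 scaler0 addr0.
by rewrite map_delta_mx cvec_delta.
Qed.

Lemma rho12_right i (s : S) :
  rho (delta_mx 0 (rshift m i)) s = ii *: (calpha (s : Cl) * cgen C i).
Proof.
rewrite /rho_12mod4 !delta_halves /cvecC map_mx0 cvec0 mul0r add0r.
by rewrite map_delta_mx cvec_delta.
Qed.

(** The real part of the Hermitian scalar product for which the e_A are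
    orthonormal. *)
Definition hdot (s t : S) : R :=
  complex.Re (\sum_A (s : Cl) A * conjc ((t : Cl) A)).

Lemma opI_linear : linear (@opI R m).
Proof.
move=> a u v; rewrite !rscaleE /opI scalerDr !scalerA.
by rewrite [ii * _]mulrC.
Qed.

Lemma opE_linear : linear (@opE R m).
Proof. by move=> a u v; rewrite !rscaleE /opE calpha_linear. Qed.

Lemma opJ_linear : linear (@opJ R m).
Proof.
move=> a u v; rewrite !rscaleE /opJ cconjD cconjZ mulrDr -scalerAr.
by rewrite conjc_real.
Qed.

Lemma hdot_I s t : hdot (opI s) (opI t) = hdot s t.
Proof.
rewrite /hdot; congr complex.Re; apply: eq_bigr => A _.
rewrite /opI !ffunE conjcM mulrACA.
by rewrite conjc_ii mulrN ii_sqr opprK mul1r.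
Qed.

Lemma hdot_E s t : hdot (opE s) (opE t) = hdot s t.
Proof.
rewrite /hdot; congr complex.Re; apply: eq_bigr => A _.
rewrite /opE !ffunE conjcM mulrACA.
by rewrite conjc_sign -expr2 sqrr_sign mul1r.
Qed.

Lemma hdot_J s t : hdot (opJ s) (opJ t) = hdot s t.
Proof.
rewrite /hdot (reindex_inj (inv_inj (symdiffK setT))) /=.
rewrite -[RHS]Re_conjc conjc_sum; congr complex.Re; apply: eq_bigr => A _.
rewrite /opJ cvolE !cbasisMlE !symdiffK !conjcM mulrACA.
by rewrite conjc_sign csign_sqr mul1r !ffunE.
Qed.

Lemma opI_admissible : admissible_op rho hdot true false (@opI R m).
Proof.
split=> [|s|s t|v s]; [exact: opI_linear | | exact: hdot_I |].
- by rewrite /opI scalerA ii_sqr expr1 !scaleN1r.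
- rewrite scale1r /opI /rho_12mod4 scalerDr calphaZ -!scalerAr.
  by rewrite -scalerAl.
Qed.

Lemma opE_admissible : admissible_op rho hdot false true (@opE R m).
Proof.
split=> [|s|s t|v s]; [exact: opE_linear | | exact: hdot_E |].
- by rewrite /opE calphaK scale1r.
- have ax : calpha (cvecC (lsubmx v)) = - cvecC (lsubmx v) by exact: calpha_cvec.
  have ay : calpha (cvecC (rsubmx v)) = - cvecC (rsubmx v) by exact: calpha_cvec.
  rewrite expr1 scaleN1r /opE /rho_12mod4.
  move: (cvecC _) (cvecC (rsubmx v)) ax ay => x y ax ay.
  by rewrite calphaD calphaZ !calphaM ax ay mulrN mulNr scalerN opprD.
Qed.

Lemma opJ_admissible : admissible_op rho hdot true (~~ odd m) (@opJ R m).
Proof.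
split=> [|s|s t|v s]; [exact: opJ_linear | | exact: hdot_J |].
- rewrite /opJ cconjM cconjK cconj_vol mulrA w_sqr mulN1r.
  by rewrite expr1 scaleN1r.
- have wx := w_comm (cvecC (lsubmx v)).
  have ax : calpha (cvecC (lsubmx v)) = - cvecC (lsubmx v) by exact: calpha_cvec.
  have [cx cy] := (cconj_cvec (lsubmx v), cconj_cvec (rsubmx v)).
  rewrite /opJ /rho_12mod4 rscaleE rmorph_sign.
  move: (cvecC _) (cvecC (rsubmx v)) cx cy wx ax => x y cx cy wx ax.
  rewrite cconjD cconjZ (cconjM x) (cconjM _ y) cx cy cconj_alpha conjc_ii.
  rewrite (calphaM w) alpha_w; move: (cconj s) => c.
  rewrite (mulrDr w) (mulrA w x) wx -scalerAr (mulrA w _ y).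
  case: (odd m) => /=; rewrite ?expr0 ?expr1 ?scale1r !scaleN1r.
    by rewrite !mulNr scalerN scaleNr mulrA.
  by rewrite ax !mulNr scaleNr opprD mulrA.
Qed.

Lemma opIE s : opI (opE s) = opE (opI s) :> S.
Proof. by rewrite /opI /opE calphaZ. Qed.

Lemma opJE s : opJ (opE s) = (-1) ^+ odd m *: opE (opJ s) :> S.
Proof.
rewrite /opJ /opE cconj_alpha calphaM alpha_w -scalerAl.
by rewrite rscaleE rmorph_sign scalerA -expr2 sqrr_sign scale1r.
Qed.

Lemma opIJ s : opI (opJ s) = - opJ (opI s) :> S.
Proof.
by rewrite /opI /opJ cconjZ -scalerAr conjc_ii scaleNr opprK.
Qed.

(** The operator s |-> conj(s) w: antilinear, of square -1, and commuting with
    Clifford multiplication whatever the parity of m. *)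
Definition opQ (s : S) : S := if odd m then opJ s else opE (opJ s).

Lemma opQ_admissible : admissible_op rho hdot true false opQ.
Proof.
have admJ := opJ_admissible; have EJ := opJE.
rewrite /opQ; case m_odd: (odd m) in admJ EJ *; first exact: admJ.
apply: (admissible_comp (d := false) opE_admissible admJ) => s.
by rewrite EJ !scale1r.
Qed.

Lemma opIQ s : opI (opQ s) = - opQ (opI s) :> S.
Proof.
rewrite /opQ; case: (odd m); rewrite ?opIE opIJ //.
by rewrite /opE calphaN.
Qed.

(** Complex scalar multiplication in terms of the real structure and I. *)
Lemma scale_decomp (a : C) (u : S) :
  a *: (u : Cl) = complex.Re a *: u + complex.Im a *: opI u :> S.
Proof.
by rewrite [a in LHS]complexE scalerDl [ii * _]mulrC -scalerA.
Qed.

(** An I-invariant form of the first type is the real part of a complex multiple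
    of the Hermitian scalar product. *)
Lemma typed_form_I_invariant b :
    typed_form rho false b -> (forall s t, b (opI s) (opI t) = b s t) ->
  exists x y, forall s t, b s t = x * hdot s t + y * hdot (opI s) t.
Proof.
move=> [bb bt] bI.
have II s : opI (opI s) = - s :> S by rewrite /opI scalerA ii_sqr scaleN1r.
have bIr s t : b s (opI t) = - b (opI s) t.
  by rewrite -[b (opI s) t]bI II (bilinNl bb) opprK.
have IP (a : C) (u v : Cl) : opI (a *: u + v : Cl) = a *: (opI u : Cl) + opI v.
  by rewrite /opI scalerDr !scalerA [a * _]mulrC.
have bl (a : C) (u v : Cl) (t : S) : b (a *: u + v) t =
    complex.Re a * b u t + complex.Im a * b (opI u) t + b v t.
  rewrite -!(bilinZl bb) -!(bilinDl bb); congr (b _ t).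
  by rewrite -scale_decomp.
have br (a : C) (u v : Cl) (s : S) : b s (a *: u + v) =
    complex.Re a * b s u + complex.Im a * b s (opI u) + b s v.
  rewrite -!(bilinZr bb) -!(bilinDr bb); congr (b s _).
  by rewrite -scale_decomp.
(* B s t = b s (conj t) - i b (is) (conj t), complex bilinear in s and t. *)
pose B (s t : Cl) : C := Complex (b s (cconj t)) (- b (opI s) (cconj t)).
have Bbil : (forall t, scalar (B^~ t)) /\ (forall s, scalar (B s)).
  split=> [t a u v|s a u v]; rewrite /B.
    rewrite IP !bl II (bilinNl bb); case: a => p q.
    by apply/eqP; rewrite eq_complex /=; apply/andP; split; apply/eqP; ring.
  rewrite cconjD cconjZ !br !bIr II (bilinNl bb); case: a => p q.
  by apply/eqP; rewrite eq_complex /=; apply/andP; split; apply/eqP; ring.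
have Bl i s t : B (cgen C i * s) (cgen C i * t) = B s t.
  rewrite /B cconjM cconj_cbasis; congr Complex.
    by rewrite -!rho12_left bt mul1r.
  by rewrite /opI scalerAr -!rho12_left bt mul1r.
have bR i (s t : Cl) : b (calpha s * cgen C i) (calpha t * cgen C i) = b s t.
  by rewrite -bI; have := bt (rshift m i) s t; rewrite !rho12_right mul1r.
have Br i s t : B (calpha s * cgen C i) (calpha t * cgen C i) = B s t.
  rewrite /B cconjM cconj_cbasis cconj_alpha; congr Complex.
    exact: bR.
  have -> : opI (calpha s * cgen C i : Cl) = calpha (opI s) * cgen C i :> Cl.
    by rewrite /opI calphaZ scalerAl.
  by rewrite bR.
have BE := clifford_form_unique Bbil Bl Br.
exists (complex.Re (B 1 1)), (complex.Im (B 1 1)) => s t.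
have -> : b s t = complex.Re (B s (cconj t)) by rewrite /= cconjK.
rewrite BE /hdot.
have -> : \sum_A (opI s : Cl) A * conjc ((t : Cl) A) =
    ii * \sum_A (s : Cl) A * conjc ((t : Cl) A).
  by rewrite mulr_sumr; apply: eq_bigr => A _; rewrite !ffunE mulrA.
have -> : \sum_A (s : Cl) A * (cconj t) A = \sum_A (s : Cl) A * conjc ((t : Cl) A).
  by apply: eq_bigr => A _; rewrite ffunE.
case: (B 1 1) (\sum_A _) => [p q] [u v] /=; ring.
Qed.

Lemma hdot_sym s t : hdot s t = hdot t s.
Proof.
rewrite /hdot -Re_conjc conjc_sum; congr complex.Re; apply: eq_bigr => A _.
by rewrite conjcM conjcK mulrC.
Qed.

Lemma hdot_bilinear : bilinear_form hdot.
Proof.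
have L t : scalar (hdot^~ t).
  move=> a u v; rewrite /hdot.
  have -> : \sum_A (a *: u + v : S) A * conjc ((t : Cl) A) =
      real_complex R a * (\sum_A (u : Cl) A * conjc ((t : Cl) A)) +
      \sum_A (v : Cl) A * conjc ((t : Cl) A).
    rewrite mulr_sumr -big_split; apply: eq_bigr => A _.
    by rewrite rscaleE !ffunE mulrDl -mulrA.
  by case: (\sum_A _) (\sum_A _) => [p q] [p' q'] /=; ring.
split=> [//|s a u v]; by rewrite hdot_sym L ![hdot _ s]hdot_sym.
Qed.

Lemma hdot_skew kap A s t : admissible_op rho hdot true kap A ->
  hdot (A s) t = - hdot (A t) s.
Proof.
move=> [_ AA hA _]; rewrite -[LHS]hA AA expr1 scaleN1r.
by rewrite (bilinNl hdot_bilinear) hdot_sym.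
Qed.

Lemma opIQ_admissible : admissible_op rho hdot true false (@opI R m \o opQ).
Proof.
apply: (admissible_comp (d := true) opI_admissible opQ_admissible) => s.
by rewrite opIQ expr1 scaleN1r.
Qed.

(** Split b into its I-invariant and I-anti-invariant halves; since I Q = - Q I,
    composing the second with Q makes it I-invariant. *)
Lemma typed_form_span b : typed_form rho false b ->
  exists x y z u, forall s t, b s t = x * hdot s t + y * hdot (opI s) t +
    z * hdot (opQ s) t + u * hdot (opI (opQ s)) t.
Proof.
move=> bt; have [bb _] := bt.
have [linI II _ rI] := opI_admissible; have [linQ QQ _ rQ] := opQ_admissible.
pose b1 s t := 2^-1 * b s t + 2^-1 * b (opI s) (opI t).
pose b2 s t := 2^-1 * b s t + - 2^-1 * b (opI s) (opI t).
have half c d : typed_form rho false (fun s t => c * b s t + d * b (opI s) (opI t)).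
  exact: typed_form_lin bt (typed_form_op2 linI rI bt).
have II' s : opI (opI s) = - s :> S by rewrite II expr1 scaleN1r.
have [|x [y b1E]] := typed_form_I_invariant (half 2^-1 2^-1).
  by move=> s t; rewrite !II' (bilinNl bb) (bilinNr bb); ring.
have b2t : typed_form rho false (form_op b2 opQ).
  exact: typed_form_op linQ rQ (half 2^-1 (- 2^-1)).
have b2b : bilinear_form b2 := (half 2^-1 (- 2^-1)).1.
have [|z [u b2E]] := typed_form_I_invariant b2t.
  move=> s t; have QI v : opQ (opI v) = - opI (opQ v) :> S by rewrite opIQ opprK.
  rewrite /form_op QI (bilinNl b2b) /b2 !II' (bilinNl bb) (bilinNr bb); ring.
exists x, y, (- z), (- u) => s t.
have -> : b s t = b1 s t + b2 s t by rewrite /b1 /b2; field.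
have -> : b2 s t = - form_op b2 opQ (opQ s) t.
  by rewrite /form_op QQ (bilinZl b2b); ring.
rewrite [b1 s t]b1E b2E; ring.
Qed.

Section Forms.
Variable h : S -> S -> R.
Hypothesis hinv : invariant_inner_product rho h.
Hypothesis m_gt0 : (0 < m)%N.

(** The forms hdot (I s) t, hdot (Q s) t and hdot (I Q s) t are skew, so a
    symmetric invariant form only has an hdot component. *)
Lemma invariant_product_hdot : exists2 c, c != 0 & forall s t, h s t = c * hdot s t.
Proof.
have [hb hsym hpos _] := hinv.
have [x [y [z [u hE]]]] := typed_form_span (form_typed hinv).
have hx s t : h s t = x * hdot s t.
  have e1 := hE s t; have e2 := hE t s; rewrite hsym in e2.
  rewrite (hdot_sym t) (hdot_skew t s opI_admissible) in e2.
  rewrite (hdot_skew t s opQ_admissible) in e2.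
  have /= e3 := hdot_skew t s opIQ_admissible; rewrite e3 in e2; lra.
exists x => //; apply/eqP=> x0.
by have := hpos 1 (oner_neq0 Cl); rewrite hx x0 mul0r ltxx.
Qed.

Lemma admissible_hdot eps kap A :
  admissible_op rho hdot eps kap A -> admissible_op rho h eps kap A.
Proof.
have [c _ hE] := invariant_product_hdot.
by move=> [linA AA hA rA]; split=> // s t; rewrite !hE hA.
Qed.

Lemma typed_form_span_product b : typed_form rho false b ->
  exists x y z u, forall s t, b s t = x * h s t + y * h (opI s) t +
    z * h (opQ s) t + u * h (opI (opQ s)) t.
Proof.
have [c c0 hE] := invariant_product_hdot.
have dE s t : hdot s t = c^-1 * h s t by rewrite hE mulKf.
move=> /typed_form_span[x [y [z [u bE]]]].
exists (x / c), (y / c), (z / c), (u / c) => s t.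
rewrite bE (dE s) (dE (opI s)) (dE (opQ s)) (dE (opI (opQ s))).
move: (h s t) (h (opI s) t) (h (opQ s) t) (h (opI (opQ s)) t) => h1 h2 h3 h4.
ring.
Qed.

Lemma rho12_span f : equivariant_embedding rho f ->
  jspan rho h [:: id; @opI R m; @opJ R m; @opK R m; @opE R m;
    @opE R m \o @opI R m; @opE R m \o @opJ R m; @opE R m \o @opK R m] f.
Proof.
move: f; apply: (jspan_quaternionic rho12_module hinv (o := odd m)).
- by rewrite addn_gt0 m_gt0.
- exact: opI_linear.
- exact: admissible_hdot opE_admissible.
- exact: opIE.
- by move=> s; rewrite opJE; case: (odd m).
- exact: typed_form_span_product.
Qed.

Lemma opI_h : admissible_op rho h true false (@opI R m).
Proof. exact: admissible_hdot opI_admissible. Qed.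

Lemma opE_h : admissible_op rho h false true (@opE R m).
Proof. exact: admissible_hdot opE_admissible. Qed.

Lemma opJ_h : admissible_op rho h true (~~ odd m) (@opJ R m).
Proof. exact: admissible_hdot opJ_admissible. Qed.

Lemma opK_h : admissible_op rho h true (~~ odd m) (@opK R m).
Proof.
apply: (admissible_comp (d := true) opI_h opJ_h) => s.
by rewrite opIJ expr1 scaleN1r.
Qed.

Lemma opEI_h : admissible_op rho h true true (@opE R m \o @opI R m).
Proof.
apply: (admissible_comp (d := false) opE_h opI_h) => s.
by rewrite opIE scale1r.
Qed.

Lemma opKE s : opK (opE s) = (-1) ^+ odd m *: opE (opK s) :> S.
Proof.
have IE u : opI (opE u) = (-1) ^+ false *: opE (opI u) :> S.
  by rewrite opIE scale1r.
exact: sign_commute_comp opI_linear IE opJE s.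
Qed.

Lemma opEJ_h : admissible_op rho h (~~ odd m) (odd m) (@opE R m \o @opJ R m).
Proof.
have EA s : opE (opJ s) = (-1) ^+ odd m *: opJ (opE s) :> S.
  by rewrite opJE scalerA -expr2 sqrr_sign scale1r.
have := admissible_comp opE_h opJ_h EA.
by rewrite addbF addbT addTb negbK.
Qed.

Lemma opEK_h : admissible_op rho h (~~ odd m) (odd m) (@opE R m \o @opK R m).
Proof.
have EA s : opE (opK s) = (-1) ^+ odd m *: opK (opE s) :> S.
  by rewrite opKE scalerA -expr2 sqrr_sign scale1r.
have := admissible_comp opE_h opK_h EA.
by rewrite addbF addbT addTb negbK.
Qed.

End Forms.
End ComplexModel.

(** * The classification *)

Theorem theorem4p8 (R : realType) (m : nat) (hm : (1 <= m)%N) :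
  [/\ (* (a) *)
      (m %% 4 = 0)%N ->
      forall h : clifford R m -> clifford R m -> R,
        invariant_inner_product (@rho_0mod4 R m) h ->
        let j A := jrho (@rho_0mod4 R m) (form_op h A) in
        [/\ forall f, equivariant_embedding (@rho_0mod4 R m) f ->
              jspan (@rho_0mod4 R m) h [:: id; @calpha R m] f,
            embeds_into (@rho_0mod4 R m)
              (wedge_pm (@ceven R m) (@codd R m)) (j id)
          & embeds_into (@rho_0mod4 R m)
              (vee_pm (@ceven R m) (@codd R m)) (j (@calpha R m))],
      (* (b) *)
      (m %% 4 = 3)%N ->
      forall h : clifford R m -> clifford R m -> R,
        invariant_inner_product (@rho_3mod4 R m) h ->
        let j A := jrho (@rho_3mod4 R m) (form_op h A) in
        [/\ forall f, equivariant_embedding (@rho_3mod4 R m) f ->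
              jspan (@rho_3mod4 R m) h [:: id; @opJ3 R m] f,
            embeds_into (@rho_3mod4 R m) (@skew_form R _) (j id)
          & embeds_into (@rho_3mod4 R m) (@skew_form R _) (j (@opJ3 R m))]
    & (* (c) *)
      (m %% 4 = 1)%N \/ (m %% 4 = 2)%N ->
      forall h : cclifford R m -> cclifford R m -> R,
        invariant_inner_product (@rho_12mod4 R m) h ->
        let E := @opE R m in
        let I := @opI R m in
        let J := @opJ R m in
        let K := @opK R m in
        let j A := jrho (@rho_12mod4 R m) (form_op h A) in
        let wedge := embeds_into (@rho_12mod4 R m)
          (wedge_pm (@cS_even R m) (@cS_odd R m)) in
        let vee := embeds_into (@rho_12mod4 R m)
          (vee_pm (@cS_even R m) (@cS_odd R m)) in
        let vee2 := embeds_into (@rho_12mod4 R m)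
          (vee2_sum (@cS_even R m) (@cS_odd R m)) in
        [/\ forall f, equivariant_embedding (@rho_12mod4 R m) f ->
              jspan (@rho_12mod4 R m) h
                [:: id; I; J; K; E; E \o I; E \o J; E \o K] f,
            (m %% 4 = 1)%N ->
              [/\ wedge (j id) /\ wedge (j (E \o I)),
                  vee (j I) /\ vee (j E)
                & [/\ vee2 (j J), vee2 (j K), vee2 (j (E \o J))
                    & vee2 (j (E \o K))]]
          & (m %% 4 = 2)%N ->
              [/\ wedge (j id), wedge (j J), wedge (j K)
                & wedge (j (E \o I))] /\
              [/\ vee (j I), vee (j E), vee (j (E \o J))
                & vee (j (E \o K))]]].
Proof.
have nz (F : comNzRingType) : exists s : clifford F m, s != 0.
  by exists 1; exact: oner_neq0.
split=> [m0|m3|m12] h hinv.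
- move=> j; have adm := alpha_admissible m0 hinv.
  have cmod := @rho0_module R m m0.
  have Sp := @ceven_alpha R m; have Sm := @codd_alpha R m.
  split; first exact: rho0_span.
    exact: (embeds_wedge_pm cmod hinv adm Sp Sm (nz R) (admissible_id _ _)).
  exact: (embeds_vee_pm cmod hinv adm Sp Sm (nz R) adm).
- move=> j; have adm := J3_admissible m3 hinv; have cmod := @rho3_module R m m3.
  have skew eps A : admissible_op (@rho_3mod4 R m) h eps eps A ->
      embeds_into (@rho_3mod4 R m) (@skew_form R _) (j A).
    move=> admA; split=> [|v s t].
      exact: (jrho_embedding cmod hinv (nz R) admA).
    by rewrite /j (jrho_symmetry cmod hinv v s t admA) addbb expr0 mulN1r.
  split; first exact: rho3_span.
    exact: skew (admissible_id _ _).
  exact: skew adm.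
- move=> E I J K j wedge vee vee2.
  have cmod := @rho12_module R m.
  have admE := opE_h m12 hinv.
  have Sp s : cS_even s -> E s = s by exact: ceven_alpha.
  have Sm s : cS_odd s -> E s = - s by exact: codd_alpha.
  have wedgeP := embeds_wedge_pm cmod hinv admE Sp Sm (nz _).
  have veeP := embeds_vee_pm cmod hinv admE Sp Sm (nz _).
  have vee2P := embeds_vee2_sum cmod hinv admE Sp Sm (nz _).
  have [[admI admJ] admK] := (opI_h m12 hinv, opJ_h m12 hinv, opK_h m12 hinv).
  have [[admEI admEJ] admEK] := (opEI_h m12 hinv, opEJ_h m12 hinv, opEK_h m12 hinv).
  have IE s : I (E s) = E (I s) by exact: opIE.
  have EIE s : (E \o I) (E s) = E ((E \o I) s) by rewrite /comp IE.
  have JE s : J (E s) = (-1) ^+ odd m *: E (J s) by exact: opJE.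
  have KE s : K (E s) = (-1) ^+ odd m *: E (K s) by exact: opKE.
  split; first exact: rho12_span.
    move=> m1; have m_odd : odd m by rewrite (divn_eq m 4) m1 oddD oddM andbF.
    rewrite m_odd /= in admJ admK admEJ admEK JE KE.
    have JE' s : J (E s) = - E (J s) by rewrite JE expr1 scaleN1r.
    have KE' s : K (E s) = - E (K s) by rewrite KE expr1 scaleN1r.
    have EN s : E (- s) = - E s by exact: calphaN.
    have EJE s : (E \o J) (E s) = - E ((E \o J) s) by rewrite /comp JE' EN.
    have EKE s : (E \o K) (E s) = - E ((E \o K) s) by rewrite /comp KE' EN.
    split.
    - split; first exact: (wedgeP _ _ _ (admissible_id _ _)).
      exact: (wedgeP _ _ _ admEI EIE).
    - by split; [exact: (veeP _ _ _ admI IE) | exact: (veeP _ _ _ admE)].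
    - split; first exact: (vee2P _ _ _ admJ JE').
      + exact: (vee2P _ _ _ admK KE').
      + exact: (vee2P _ _ _ admEJ EJE).
      + exact: (vee2P _ _ _ admEK EKE).
  move=> m2; have m_even : odd m = false.
    by rewrite (divn_eq m 4) m2 oddD oddM andbF.
  rewrite m_even /= in admJ admK admEJ admEK JE KE.
  have JE' s : J (E s) = E (J s) by rewrite JE scale1r.
  have KE' s : K (E s) = E (K s) by rewrite KE scale1r.
  have EJE s : (E \o J) (E s) = E ((E \o J) s) by rewrite /comp JE'.
  have EKE s : (E \o K) (E s) = E ((E \o K) s) by rewrite /comp KE'.
  split; split.
  - exact: (wedgeP _ _ _ (admissible_id _ _)).
  - exact: (wedgeP _ _ _ admJ JE').
  - exact: (wedgeP _ _ _ admK KE').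
  - exact: (wedgeP _ _ _ admEI EIE).
  - exact: (veeP _ _ _ admI IE).
  - exact: (veeP _ _ _ admE).
  - exact: (veeP _ _ _ admEJ EJE).
  - exact: (veeP _ _ _ admEK EKE).
Qed.
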